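(* Assume that $\mu \colon \mathcal{P}^2_o \to \mathbb{R}^2$ is a measurable valuation which is $\mathrm{VL}(2)$-signum-covariant, i.e. $\mu(\phi P) = (\det\phi)\,\phi\,\mu(P)$ for all $P \in \mathcal{P}^2_o$ and all $\phi \in \mathrm{VL}(2)$. Then there exists $k \in \mathbb{R}$ such that $\mu(P) = k\,\rho_{\frac{\pi}{2}}\, m(P^* )$ for all $P \in \mathcal{P}^2_o$.
   Context: $\mathcal{P}^2_o$ denotes the set of convex polygons in $\mathbb{R}^2$ containing the origin in their interiors, with the Hausdorff metric topology; ''measurable'' refers to Borel $\sigma$-algebras. $\mathrm{VL}(2)$ is the group of linear maps of $\mathbb{R}^2$ with determinant $1$ or $-1$. A map $\mu$ on a family $\mathcal{S}$ of sets is a valuation if $\mu(K \cup L) + \mu(K \cap L) = \mu(K) + \mu(L)$ whenever $K, L, K\cup L, K \cap L \in \mathcal{S}$. The moment vector is $m(P) = \int_P x\,dx$; $P^* = \{y : y^t x \le 1 \ \forall x \in P\}$ is the polar body; $\rho_{\frac{\pi}{2}}$ is the counter-clockwise rotation of $\mathbb{R}^2$ by $\frac{\pi}{2}$. *)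

(* Defs.v *)
From HB Require Import structures.
From mathcomp Require Import all_boot all_order all_algebra.
From mathcomp Require Import all_classical all_reals all_analysis.
Set Implicit Arguments. Unset Strict Implicit. Unset Printing Implicit Defensive.
Import Order.TTheory GRing.Theory Num.Theory.
Import numFieldNormedType.Exports.
Local Open Scope classical_set_scope.
Local Open Scope ring_scope.

Section Defs.
Variable R : realType.
Notation pt := (R * R)%type.

Definition dot2 (x y : pt) : R := x.1 * y.1 + x.2 * y.2.
Definition dist2 (x y : pt) : R :=
  Num.sqrt ((x.1 - y.1) ^+ 2 + (x.2 - y.2) ^+ 2).

Definition add2 (x y : pt) : pt := (x.1 + y.1, x.2 + y.2).
Definition scale2 (k : R) (x : pt) : pt := (k * x.1, k * x.2).

Definition lapp (A : 'M[R]_2) (x : pt) : pt :=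
  (A 0 0 * x.1 + A 0 1 * x.2, A 1 0 * x.1 + A 1 1 * x.2).
Definition limage (A : 'M[R]_2) (P : set pt) : set pt := lapp A @` P.
Definition VL2 (A : 'M[R]_2) : Prop := \det A = 1 \/ \det A = -1.

Definition rot90 (x : pt) : pt := (- x.2, x.1).

(* convex polygon: convex hull of finitely many points, with nonempty
   interior (the interior condition is implied by membership in P^2_o) *)
Definition conv_hull_fin (n : nat) (v : 'I_n -> pt) : set pt :=
  [set x | exists l : 'I_n -> R, (forall i, 0 <= l i) /\
     \sum_(i < n) l i = 1 /\
     x = (\sum_(i < n) l i * (v i).1, \sum_(i < n) l i * (v i).2)].
Definition convex_polygon (P : set pt) : Prop :=
  exists (n : nat) (v : 'I_n -> pt), P = conv_hull_fin v.

Definition Po : set (set pt) :=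
  [set P | convex_polygon P /\ interior P (0 : pt)].

Definition polar (P : set pt) : set pt := [set y | forall x, P x -> dot2 y x <= 1].

Definition leb2 := ((@lebesgue_measure R) \x (@lebesgue_measure R))%E.
Definition moment (P : set pt) : pt :=
  (Rintegral leb2 P fst, Rintegral leb2 P snd).

Definition hclose (P Q : set pt) (e : R) : Prop :=
  (forall x, P x -> exists y, Q y /\ dist2 x y < e) /\
  (forall y, Q y -> exists x, P x /\ dist2 x y < e).

Definition Hopen (U : set (set pt)) : Prop :=
  U `<=` Po /\
  forall P, U P -> exists2 e : R, 0 < e &
    forall Q, Po Q -> hclose P Q e -> U Q.

Definition Borel_measurable_Po (mu : set pt -> pt) : Prop :=
  forall B : set pt, measurable B ->
    <<s Po, Hopen >> (Po `&` (mu @^-1` B)).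

Definition valuation_Po (mu : set pt -> pt) : Prop :=
  forall K L, Po K -> Po L -> Po (K `|` L) -> Po (K `&` L) ->
    add2 (mu (K `|` L)) (mu (K `&` L)) = add2 (mu K) (mu L).

Definition VL2_signum_covariant (mu : set pt -> pt) : Prop :=
  forall (A : 'M[R]_2) P, VL2 A -> Po P ->
    mu (limage A P) = scale2 (\det A) (lapp A (mu P)).

End Defs.

(* Main.v *)
(* The paper's statement is dual to a classification of moment vectors, and the
   whole argument is carried out on the dual side: a polygon is written
   [halfplanes U], the set on which all the functionals of [U] are at most 1, so
   that [U] spans the polar body and P |-> rot^-1 mu(P) is linearly covariant in
   [U].  After subtracting the right multiple of the moment vector of the polar
   body, a value N on lists [U] remains that has to vanish.

   For fixed poles (0, c), (0, -d) the value of N on the quadrilaterals with two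
   further points x and y on either side of the axis splits as r(x) + l(y).
   Covariance under shears determines r up to an additive function of the slope
   of x.  Measurability, used only here, makes that function linear.  The reflections and the
   diagonal maps then reduce N on quadrilaterals to one function g of one variable, and
   the symmetry of isosceles triangles gives a functional equation that forces
   g(w) = g(2) (w^2 - 1) / 3; the normalisation was chosen so that g(2) = 0.

   For a general polygon, Steinitz's theorem provides a point v of [U] whose
   removal keeps the origin in the interior of the hull; if x and y are the
   neighbours of v, then N(U) - N(U \ v) is the difference between the values on a
   quadrilateral x, v, y, w and a triangle x, y, w, which are both 0. *)
Require Import Defs.
From HB Require Import structures.
From mathcomp Require Import all_boot all_order all_algebra.
From mathcomp Require Import all_classical all_reals all_analysis.
From mathcomp Require Import measurable_realfun ring lra.
Set Implicit Arguments. Unset Strict Implicit. Unset Printing Implicit Defensive.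
Import Order.TTheory GRing.Theory Num.Theory.
Import numFieldNormedType.Exports.
Local Open Scope classical_set_scope.
Local Open Scope ring_scope.

(** * Polygons as finite intersections of half-planes *)

Section Halfplanes.
Variable R : realType.
Notation pt := (R * R)%type.
Implicit Types (U V W : seq pt) (x u : pt).

(** The covariance has the right form because [rho^-1 phi rho = (det phi) phi^-T] for the rotation
    [rho] and [phi] in VL(2): the sign in the hypothesis cancels, and when [phi] acts on the
    polygon, [phi^-T] acts both on the constraints and on the rotated value. Boundedness of
    [halfplanes U] says that [U] surrounds the origin and takes the place of membership in [Po].
    This condition shapes the proof: the polar body cannot be cut into triangles with a vertex at
    the origin, since every piece needs the origin in its interior. Hence the pieces are
    quadrilaterals with a diagonal through the origin, and a triangle counts as one whose pole lies
    on a side. One constant suffices for the normalisation because the functional equation leaves a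
    single degree of freedom, which the moment vector realises with a nonzero value at 2.
    Measurability lives on the space of polygons; a Hausdorff-continuous path of quadrilaterals
    carries it to the line, where it yields a bound on a set of measure more than 3/4 in the unit
    interval. *)

Definition halfplanes U : set pt := [set x | forall u, u \in U -> dot2 u x <= 1].

Lemma halfplanes_nil x : halfplanes [::] x.
Proof. by move=> u. Qed.

Lemma halfplanes_cons u U x :
  halfplanes (u :: U) x <-> dot2 u x <= 1 /\ halfplanes U x.
Proof.
split=> [h|[h1 h2] v]; last by rewrite inE => /orP[/eqP ->|/h2].
by split=> [|v vU]; apply: h; rewrite inE ?eqxx ?vU ?orbT.
Qed.

Lemma halfplanes_cat U V : halfplanes (U ++ V) = halfplanes U `&` halfplanes V.
Proof.
apply/seteqP; split=> x /=.
  by move=> h; split=> u uU; apply: h; rewrite mem_cat uU ?orbT.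
by move=> [h1 h2] u; rewrite mem_cat => /orP[/h1|/h2].
Qed.

Lemma sub_halfplanes U V : {subset U <= V} -> halfplanes V `<=` halfplanes U.
Proof. by move=> sUV x h u /sUV /h. Qed.

Definition sqbounded (P : set pt) : Prop :=
  exists r : R, forall x, P x -> `|x.1| <= r /\ `|x.2| <= r.

Lemma sub_sqbounded (P Q : set pt) : P `<=` Q -> sqbounded Q -> sqbounded P.
Proof. by move=> PQ [r hr]; exists r => x /PQ /hr. Qed.

Definition lin (a b c d : R) x : pt := (a * x.1 + b * x.2, c * x.1 + d * x.2).

Lemma halfplanes_lin a b c d U x :
  halfplanes (map (lin a b c d) U) x <-> halfplanes U (lin a c b d x).
Proof.
have e u : dot2 (lin a b c d u) x = dot2 u (lin a c b d x).
  by rewrite /dot2 /=; ring.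
split=> h; first by move=> u uU; rewrite -e; apply: h; apply: map_f.
by move=> v /mapP[u uU ->]; rewrite e; apply: h.
Qed.

Lemma lin_comp a b c d a' b' c' d' x :
  lin a b c d (lin a' b' c' d' x) =
  lin (a * a' + b * c') (a * b' + b * d') (c * a' + d * c') (c * b' + d * d') x.
Proof. by rewrite /lin /=; congr pair; ring. Qed.

Lemma sqbounded_lin a b c d U : a * d - b * c != 0 ->
  sqbounded (halfplanes U) -> sqbounded (halfplanes (map (lin a b c d) U)).
Proof.
move=> D0 [r hr].
set D := a * d - b * c in D0.
exists (`|D|^-1 * ((`|a| + `|b| + `|c| + `|d|) * r)) => x /halfplanes_lin /hr [/= h1 h2].
have r0 : 0 <= r by apply: le_trans (normr_ge0 _) h1.
(* Cramer's rule: each coordinate of [x], times [D], is a combination of the coordinates of the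
   bounded point [lin a c b d x]. *)
have key s t A B : s * D = A * (a * x.1 + c * x.2) + B * (b * x.1 + d * x.2) ->
   `|A| + `|B| <= t -> `|s| <= `|D|^-1 * (t * r).
  move=> e ht; rewrite -[X in X <= _]mul1r -(mulVf (x:=`|D|)) ?normr_eq0//.
  rewrite -mulrA ler_wpM2l ?invr_ge0// mulrC -normrM e.
  apply: le_trans (ler_normD _ _) _; rewrite !normrM.
  apply: le_trans (ler_wpM2r r0 ht); rewrite mulrDl.
  by apply: lerD; apply: ler_wpM2l.
split.
  apply: (key _ _ d (- c)); first by rewrite /D; ring.
  by rewrite normrN; have := normr_ge0 a; have := normr_ge0 b; lra.
apply: (key _ _ (- b) a); first by rewrite /D; ring.
by rewrite normrN; have := normr_ge0 c; have := normr_ge0 d; lra.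
Qed.

(** The two poles bound the second coordinate; given that bound, the vertices on the right and on
    the left bound the first one from either side. *)
Lemma sqbounded_quad (c d p q p' q' : R) U : 0 < c -> 0 < d -> 0 < p -> 0 < p' ->
  {subset [:: (0, c); (0, - d); (p, q); (- p', q')] <= U} ->
  sqbounded (halfplanes U).
Proof.
move=> c0 d0 p0 p'0 /sub_halfplanes /sub_sqbounded; apply.
set m := c^-1 + d^-1.
exists (m + p^-1 * (1 + `|q| * m) + p'^-1 * (1 + `|q'| * m)) => -[X Y].
rewrite !halfplanes_cons /dot2 /= => -[h1 [h2 [h3 [h4 _]]]].
have ci : 0 < c^-1 by rewrite invr_gt0.
have di : 0 < d^-1 by rewrite invr_gt0.
have pi : 0 < p^-1 by rewrite invr_gt0.
have pi' : 0 < p'^-1 by rewrite invr_gt0.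
have Y1 : Y <= c^-1 by rewrite -(ler_pM2l c0) mulfV ?gt_eqF//; lra.
have Y2 : - Y <= d^-1 by rewrite -(ler_pM2l d0) mulfV ?gt_eqF//; lra.
have Yn : `|Y| <= m by rewrite ler_norml /m; apply/andP; split; lra.
have m0 : 0 < m by rewrite addr_gt0.
have qY (s : R) : s * Y <= `|s| * m /\ - (s * Y) <= `|s| * m.
  have h : `|s * Y| <= `|s| * m by rewrite normrM ler_wpM2l.
  by split; apply: le_trans h; rewrite ?ler_norm// -normrN ler_norm.
have hX1 : X <= p^-1 * (1 + `|q| * m).
  rewrite -(ler_pM2l p0) mulrA mulfV ?gt_eqF// mul1r; have := qY q; lra.
have hX2 : - X <= p'^-1 * (1 + `|q'| * m).
  rewrite -(ler_pM2l p'0) mulrA mulfV ?gt_eqF// mul1r; have := qY q'; lra.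
have a1 : 0 <= p^-1 * (1 + `|q| * m) by rewrite mulr_ge0 ?(ltW pi)// addr_ge0// mulr_ge0// ltW.
have a2 : 0 <= p'^-1 * (1 + `|q'| * m) by rewrite mulr_ge0 ?(ltW pi')// addr_ge0// mulr_ge0// ltW.
split; first by rewrite ler_norml; apply/andP; split; lra.
by lra.
Qed.

End Halfplanes.

(** * Valuations and covariance in terms of the constraints *)

Section Valuation.
Variable R : realType.
Notation pt := (R * R)%type.
Variable N : set pt -> pt.
Local Notation HP := (@halfplanes R).
Implicit Types (U V W : seq pt) (x u : pt).

(** Concatenating constraints intersects the polygons, so only the union has to be supplied, as
    [W]. *)
Definition hp_valuation := forall U V W, sqbounded (HP U) -> sqbounded (HP V) ->
  sqbounded (HP W) -> HP U `|` HP V = HP W ->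
  add2 (N (HP W)) (N (HP (U ++ V))) = add2 (N (HP U)) (N (HP V)).

Definition hp_covariant (a b c d : R) := forall U, sqbounded (HP U) ->
  N (HP (map (lin a b c d) U)) = lin a b c d (N (HP U)).

Hypothesis Nval : hp_valuation.
Hypothesis Nshear : forall t, hp_covariant 1 0 t 1.
Hypothesis Nswap : hp_covariant 0 1 1 0.

Lemma hp_covariant_comp a b c d a' b' c' d' : a' * d' - b' * c' != 0 ->
  hp_covariant a b c d -> hp_covariant a' b' c' d' ->
  hp_covariant (a * a' + b * c') (a * b' + b * d') (c * a' + d * c') (c * b' + d * d').
Proof.
move=> D0 h h' U bU; rewrite -lin_comp -h' // -h; last exact: sqbounded_lin.
by rewrite -map_comp; congr (N (HP _)); apply: eq_map => x /=; rewrite lin_comp.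
Qed.

Lemma hp_covariant_shear' t : hp_covariant 1 t 0 1.
Proof.
have D1 : (0 * 0 - 1 * 1 : R) != 0 by rewrite mulr0 mulr1 sub0r oppr_eq0 oner_eq0.
have D2 : (1 * 1 - 0 * t : R) != 0 by rewrite mul0r mulr1 subr0 oner_eq0.
have := hp_covariant_comp D1 (hp_covariant_comp D2 Nswap (Nshear t)) Nswap.
by congr hp_covariant; ring.
Qed.

(** For [c != 0] the matrix is the product of an upper shear by [(a - 1) / c], the lower shear by
    [c] and an upper shear by [(d - 1) / c]. For [c = 0] a lower shear makes that entry nonzero. *)
Lemma hp_covariant_det1 a b c d : a * d - b * c = 1 -> hp_covariant a b c d.
Proof.
have gen a' b' c' d' : a' * d' - b' * c' = 1 -> c' != 0 -> hp_covariant a' b' c' d'.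
  move=> D c0.
  have D1 t : (1 * 1 - 0 * t : R) != 0 by rewrite mul0r mulr1 subr0 oner_eq0.
  have D2 t : (1 * 1 - t * 0 : R) != 0 by rewrite mulr0 mulr1 subr0 oner_eq0.
  have := hp_covariant_comp (D2 ((d' - 1) / c')) (hp_covariant_comp (D1 c')
    (hp_covariant_shear' ((a' - 1) / c')) (Nshear c')) (hp_covariant_shear' ((d' - 1) / c')).
  congr hp_covariant; try by field.
  have -> : b' = (a' * d' - 1) / c' by rewrite -D; field.
  by field.
move=> D; have [c0|c0] := eqVneq c 0; last exact: gen.
have a0 : a != 0 by apply/eqP => a0; rewrite a0 c0 in D; lra.
have h1 : hp_covariant a b a (b + d) by apply: gen => //; rewrite -D c0; ring.
have D1 : a * (b + d) - b * a != 0.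
  by rewrite mulrDr [b * a]mulrC addrAC subrr add0r mulf_neq0 //; apply/eqP => d0; rewrite d0 c0 in D; lra.
have := hp_covariant_comp D1 (@Nshear (-1)) h1.
by congr hp_covariant; rewrite ?c0; ring.
Qed.

Lemma hp_covariant_detN1 a b c d : a * d - b * c = -1 -> hp_covariant a b c d.
Proof.
move=> D.
have h : hp_covariant c d a b by apply: hp_covariant_det1; lra.
have D1 : c * b - d * a != 0 by apply/eqP => e; lra.
have := hp_covariant_comp D1 Nswap h.
by congr hp_covariant; ring.
Qed.

Definition quad (c d p q p' q' : R) : seq pt :=
  [:: (0, c); (0, - d); (p, q); (- p', q')].
Definition quad_value c d p q p' q' := N (HP (quad c d p q p' q')).
Local Notation E := quad_value.

(* The segment from (p, q) to (- p', q') crosses the second axis between the poles (0, - d) and (0, c). *)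
Definition adm (c d p q p' q' : R) := - d * (p + p') <= p' * q + p * q' <= c * (p + p').

Lemma bquad c d p q p' q' : 0 < c -> 0 < d -> 0 < p -> 0 < p' ->
  sqbounded (HP (quad c d p q p' q')).
Proof. by move=> c0 d0 p0 p'0; apply: (sqbounded_quad c0 d0 p0 p'0) => u; apply. Qed.

(** The four inequalities put [(e, 0)] and [(- e, 0)] into the triangles spanned by the poles and
    one side vertex, so that replacing a vertex by such a point enlarges the polygon. The two
    polygons with one vertex replaced meet in the polygon with none replaced, and their union is the
    one with both replaced. *)
Lemma quad_val_small c d p q p' q' e : 0 < c -> 0 < d -> 0 < p -> 0 < p' -> 0 < e ->
  adm c d p q p' q' ->
  e * (q + d) <= d * p -> e * (c - q) <= c * p ->
  e * (q' + d) <= d * p' -> e * (c - q') <= c * p' ->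
  add2 (E c d p q p' q') (E c d e 0 e 0) = add2 (E c d p q e 0) (E c d e 0 p' q').
Proof.
move=> c0 d0 p0 p'0 e0 /andP[A1 A2] h1 h2 h3 h4.
have -> : add2 (E c d p q p' q') (E c d e 0 e 0) = add2 (E c d e 0 e 0) (E c d p q p' q').
  by rewrite /add2; congr pair; ring.
have ep : e <= p by rewrite -(ler_pM2r (addr_gt0 c0 d0)); lra.
have ep' : e <= p' by rewrite -(ler_pM2r (addr_gt0 c0 d0)); lra.
have sm (X Y p1 q1 : R) : 0 < p1 -> e <= p1 -> e * (q1 + d) <= d * p1 ->
    e * (c - q1) <= c * p1 -> c * Y <= 1 -> - d * Y <= 1 ->
    p1 * X + q1 * Y <= 1 -> e * X <= 1.
  move=> p10 ep1 k1 k2 Y1 Y2 Z.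
  rewrite -(ler_pM2l p10) mulr1 mulrCA.
  have : e * (p1 * X + q1 * Y) <= e by rewrite -[leRHS]mulr1 ler_pM2l.
  suff : - e * q1 * Y <= p1 - e by lra.
  have [Y0|/ltW Y0] := leP 0 Y.
    have : (- e * q1) * Y <= (c * (p1 - e)) * Y by rewrite ler_wpM2r//; lra.
    have : (p1 - e) * (c * Y) <= (p1 - e) by rewrite -[leRHS]mulr1 ler_wpM2l// subr_ge0.
    lra.
  have : (e * q1) * (- Y) <= (d * (p1 - e)) * (- Y) by rewrite ler_wpM2r//; lra.
  have : (p1 - e) * (- d * Y) <= (p1 - e) by rewrite -[leRHS]mulr1 ler_wpM2l// subr_ge0.
  lra.
have -> : E c d p q p' q' = N (HP (quad c d p q e 0 ++ quad c d e 0 p' q')).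
  congr N; apply/seteqP; split => -[X Y];
    rewrite halfplanes_cat /= !halfplanes_cons /dot2 /=.
    move=> [a1 [a2 [a3 [a4 _]]]].
    have b1 : e * X <= 1 by apply: (sm X Y p q) => //; lra.
    have b2 : e * (- X) <= 1 by apply: (sm (- X) Y p' q') => //; lra.
    by do 2 (split=> //; try lra); do !(split=> //; try lra).
  by move=> [[a1 [a2 [a3 [a4 _]]]] [_ [_ [a5 [a6 _]]]]].
apply: Nval; try exact: bquad.
apply/seteqP; split => -[X Y] /=; rewrite !halfplanes_cons /dot2 /=.
  move=> [|] [a1 [a2 [a3 [a4 _]]]].
    have b1 : e * X <= 1 by apply: (sm X Y p q) => //; lra.
    by do !(split=> //; try lra).
  have b2 : e * (- X) <= 1 by apply: (sm (- X) Y p' q') => //; lra.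
  by do !(split=> //; try lra).
move=> [a1 [a2 [a3 [a4 _]]]].
have [k|k] := leP (p * X + q * Y) 1; first by left.
have [k'|k'] := leP (- p' * X + q' * Y) 1; first by right.
exfalso.
(* A point that violates both side constraints violates their combination at the crossing with the
   axis, which by [adm] is a convex combination of the poles. *)
have l1 : p' < p' * (p * X + q * Y) by rewrite -[ltLHS]mulr1 ltr_pM2l.
have l2 : p < p * (- p' * X + q' * Y) by rewrite -[ltLHS]mulr1 ltr_pM2l.
have l3 : p + p' < (p' * q + p * q') * Y by lra.
have pp : 0 <= p + p' by lra.
have [Y0|/ltW Y0] := leP 0 Y.
  have : (p' * q + p * q') * Y <= (c * (p + p')) * Y by rewrite ler_wpM2r.
  have : (p + p') * (c * Y) <= (p + p') by rewrite -[leRHS]mulr1 ler_wpM2l//; lra.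
  lra.
have : (p' * q + p * q') * Y <= (- d * (p + p')) * Y by rewrite ler_wnM2r.
have : (p + p') * (- d * Y) <= (p + p') by rewrite -[leRHS]mulr1 ler_wpM2l//; lra.
lra.
Qed.

End Valuation.

(** * Values on quadrilaterals with a diagonal through the origin *)

Section QuadRelations.
Variable R : realType.
Notation pt := (R * R)%type.
Variable N : set pt -> pt.
Hypothesis Nval : hp_valuation N.
Hypothesis Nshear : forall t, hp_covariant N 1 0 t 1.
Hypothesis Nswap : hp_covariant N 0 1 1 0.
Local Notation HP := (@halfplanes R).
Local Notation E := (quad_value N).

Lemma small_multiplier (c d p q : R) : 0 < c -> 0 < d -> 0 < p ->
  exists2 e0, 0 < e0 & forall e, 0 < e -> e <= e0 ->
    e * (q + d) <= d * p /\ e * (c - q) <= c * p.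
Proof.
move=> c0 d0 p0; set m := Num.min c d.
have m0 : 0 < m by rewrite lt_min c0.
have s0 : 0 < c + d + `|q| by rewrite ltr_wpDr// addr_gt0.
exists (p * m / (c + d + `|q|)); first by rewrite divr_gt0// mulr_gt0.
move=> e e0; rewrite ler_pdivlMr// => h.
have qn := ler_norm q; have qn' : - q <= `|q| by rewrite -normrN ler_norm.
have mc : p * m <= p * c by rewrite ler_pM2l// ge_min lexx.
have md : p * m <= p * d by rewrite ler_pM2l// ge_min lexx orbT.
have h1 : e * (q + d) <= e * (c + d + `|q|) by rewrite ler_pM2l//; lra.
have h2 : e * (c - q) <= e * (c + d + `|q|) by rewrite ler_pM2l//; lra.
by split; lra.
Qed.

(** This is the splitting into a right and a left part, in difference form. With one [e] small
    enough for all four vertices, [quad_val_small] applies to each pairing and the term at [e]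
    cancels. *)
Lemma quad_val c d p q p' q' r s r' s' :
  0 < c -> 0 < d -> 0 < p -> 0 < p' -> 0 < r -> 0 < r' ->
  adm c d p q p' q' -> adm c d r s r' s' -> adm c d p q r' s' -> adm c d r s p' q' ->
  add2 (E c d p q p' q') (E c d r s r' s') = add2 (E c d p q r' s') (E c d r s p' q').
Proof.
move=> c0 d0 p0 p'0 r0 r'0 A1 A2 A3 A4.
have [e1 e10 h1] := small_multiplier q c0 d0 p0.
have [e2 e20 h2] := small_multiplier q' c0 d0 p'0.
have [e3 e30 h3] := small_multiplier s c0 d0 r0.
have [e4 e40 h4] := small_multiplier s' c0 d0 r'0.
set e := Num.min (Num.min e1 e2) (Num.min e3 e4).
have e0 : 0 < e by rewrite !lt_min e10 e20 e30.
have [k1 k1'] : _ /\ _ := h1 e e0 ltac:(by rewrite !ge_min lexx).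
have [k2 k2'] : _ /\ _ := h2 e e0 ltac:(by rewrite !ge_min lexx !orbT).
have [k3 k3'] : _ /\ _ := h3 e e0 ltac:(by rewrite !ge_min lexx !orbT).
have [k4 k4'] : _ /\ _ := h4 e e0 ltac:(by rewrite !ge_min lexx !orbT).
have [] := quad_val_small Nval c0 d0 p0 p'0 e0 A1 k1 k1' k2 k2'.
have [] := quad_val_small Nval c0 d0 r0 r'0 e0 A2 k3 k3' k4 k4'.
have [] := quad_val_small Nval c0 d0 p0 r'0 e0 A3 k1 k1' k4 k4'.
have [] := quad_val_small Nval c0 d0 r0 p'0 e0 A4 k3 k3' k2 k2'.
by move=> *; rewrite /add2; congr pair; lra.
Qed.

Lemma E_shear t c d p q p' q' : 0 < c -> 0 < d -> 0 < p -> 0 < p' ->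
  E c d p (q + t * p) p' (q' - t * p') = lin 1 0 t 1 (E c d p q p' q').
Proof.
move=> c0 d0 p0 p'0; rewrite /quad_value -Nshear; last exact: bquad.
by congr (N (HP _)); rewrite /quad /lin /=; do ?congr cons; congr pair; ring.
Qed.

Lemma E_diag k c d p q p' q' : 0 < k -> 0 < c -> 0 < d -> 0 < p -> 0 < p' ->
  E (c / k) (d / k) (k * p) (q / k) (k * p') (q' / k) = lin k 0 0 k^-1 (E c d p q p' q').
Proof.
move=> k0 c0 d0 p0 p'0.
rewrite /quad_value -(hp_covariant_det1 Nshear Nswap); [|by rewrite mulfV ?gt_eqF// mul0r subr0|exact: bquad].
by congr (N (HP _)); rewrite /quad /lin /=; do ?congr cons; congr pair; ring.
Qed.

Lemma E_reflect1 c d p q p' q' : 0 < c -> 0 < d -> 0 < p -> 0 < p' ->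
  E c d p' q' p q = lin (-1) 0 0 1 (E c d p q p' q').
Proof.
move=> c0 d0 p0 p'0.
rewrite /quad_value -(hp_covariant_detN1 Nshear Nswap); [|by ring|exact: bquad].
congr N; apply/seteqP; split => -[X Y];
  rewrite !halfplanes_cons /dot2 /= => -[a1 [a2 [a3 [a4 h]]]];
  split; try lra; split; try lra; split; try lra; split; try lra; exact: halfplanes_nil.
Qed.

Lemma E_reflect2 c d p q p' q' : 0 < c -> 0 < d -> 0 < p -> 0 < p' ->
  E d c p (- q) p' (- q') = lin 1 0 0 (-1) (E c d p q p' q').
Proof.
move=> c0 d0 p0 p'0.
rewrite /quad_value -(hp_covariant_detN1 Nshear Nswap); [|by ring|exact: bquad].
congr N; apply/seteqP; split => -[X Y];
  rewrite !halfplanes_cons /dot2 /= => -[a1 [a2 [a3 [a4 h]]]];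
  split; try lra; split; try lra; split; try lra; split; try lra; exact: halfplanes_nil.
Qed.

Lemma E_swap a b c d : 0 < a -> 0 < b -> 0 < c -> 0 < d ->
  E a b c 0 d 0 = lin 0 1 1 0 (E c d a 0 b 0).
Proof.
move=> a0 b0 c0 d0.
rewrite /quad_value -Nswap; last exact: bquad.
congr N; apply/seteqP; split => -[X Y];
  rewrite !halfplanes_cons /dot2 /= => -[a1 [a2 [a3 [a4 h]]]];
  split; try lra; split; try lra; split; try lra; split; try lra; exact: halfplanes_nil.
Qed.

Lemma adm0 (c d p p' : R) : 0 < c -> 0 < d -> 0 < p -> 0 < p' -> adm c d p 0 p' 0.
Proof.
move=> c0 d0 p0 p'0; rewrite /adm !mulr0 addr0 mulNr oppr_le0.
by rewrite !mulr_ge0 ?addr_ge0// ltW.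
Qed.

Definition axis_value (a b c d : R) := (E c d a 0 b 0).1.
(** The factor 1/2 accounts for the two poles, each of which contributes one copy in
    [axis_value_formula]. *)
Definition gfun a := axis_value a 1 1 1 / 2.

Lemma axis_value_anti a b c d : 0 < a -> 0 < b -> 0 < c -> 0 < d -> axis_value a b c d = - axis_value b a c d.
Proof. by move=> a0 b0 c0 d0; rewrite /axis_value E_reflect1//= /lin /=; ring. Qed.

Lemma axis_value_snd a b c d : 0 < a -> 0 < b -> 0 < c -> 0 < d -> (E c d a 0 b 0).2 = axis_value c d a b.
Proof. by move=> a0 b0 c0 d0; rewrite /axis_value E_swap// /lin /=; ring. Qed.

Lemma axis_value_sym a b c d : 0 < a -> 0 < b -> 0 < c -> 0 < d -> axis_value a b c d = axis_value a b d c.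
Proof.
move=> a0 b0 c0 d0; have := E_reflect2 0 0 c0 d0 a0 b0.
by rewrite oppr0 /axis_value => ->; rewrite /lin /=; ring.
Qed.

Lemma axis_value_val a b a' b' c d : 0 < a -> 0 < b -> 0 < c -> 0 < d -> 0 < a' -> 0 < b' ->
  axis_value a b c d + axis_value a' b' c d = axis_value a b' c d + axis_value a' b c d.
Proof.
move=> a0 b0 c0 d0 a'0 b'0; rewrite /axis_value.
by have [] := quad_val c0 d0 a0 b0 a'0 b'0 (adm0 c0 d0 a0 b0) (adm0 c0 d0 a'0 b'0)
    (adm0 c0 d0 a0 b'0) (adm0 c0 d0 a'0 b0).
Qed.

(** Exchanging the coordinates turns the poles into side vertices, so the splitting holds in the
    poles as well. *)
Lemma axis_value_val2 a b c d c' d' : 0 < a -> 0 < b -> 0 < c -> 0 < d -> 0 < c' -> 0 < d' ->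
  axis_value a b c d + axis_value a b c' d' = axis_value a b c d' + axis_value a b c' d.
Proof.
move=> a0 b0 c0 d0 c'0 d'0; rewrite -!axis_value_snd//.
by have [] := quad_val a0 b0 c0 d0 c'0 d'0 (adm0 a0 b0 c0 d0) (adm0 a0 b0 c'0 d'0)
    (adm0 a0 b0 c0 d'0) (adm0 a0 b0 c'0 d0).
Qed.

Lemma axis_value_diag k a b c d : 0 < k -> 0 < a -> 0 < b -> 0 < c -> 0 < d ->
  axis_value (k * a) (k * b) (c / k) (d / k) = k * axis_value a b c d.
Proof.
move=> k0 a0 b0 c0 d0; rewrite /axis_value.
have := E_diag 0 0 k0 c0 d0 a0 b0; rewrite mul0r => ->; rewrite /lin /=; ring.
Qed.

(** Splitting and antisymmetry settle unit poles, and a diagonal map then settles equal poles.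
    Splitting in the poles and their symmetry show that unequal poles give the mean of the two equal
    cases. *)
Lemma axis_value_formula a b c d : 0 < a -> 0 < b -> 0 < c -> 0 < d ->
  axis_value a b c d = (gfun (a * c) - gfun (b * c)) / c + (gfun (a * d) - gfun (b * d)) / d.
Proof.
move=> a0 b0 c0 d0.
have D11 a1 b1 : 0 < a1 -> 0 < b1 -> axis_value a1 b1 1 1 = 2 * (gfun a1 - gfun b1).
  move=> a10 b10; rewrite /gfun.
  have := axis_value_val a10 b10 ltr01 ltr01 ltr01 ltr01.
  have := axis_value_anti ltr01 b10 ltr01 ltr01.
  have := axis_value_anti ltr01 ltr01 ltr01 ltr01.
  by lra.
have Dcc x : 0 < x -> axis_value a b x x = 2 * (gfun (a * x) - gfun (b * x)) / x.
  move=> x0; rewrite -D11 ?mulr_gt0//.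
  have := axis_value_diag x0 a0 b0 x0 x0; rewrite mulfV ?gt_eqF// [x * a]mulrC [x * b]mulrC => ->.
  by field; rewrite gt_eqF.
have := axis_value_val2 a0 b0 c0 d0 d0 c0.
rewrite (@axis_value_sym a b d c)// !Dcc// => h.
lra.
Qed.

End QuadRelations.

(** * Dependence on the slopes of the side vertices *)

Section QuadFormula.
Variable R : realType.
Notation pt := (R * R)%type.
Variable N : set pt -> pt.
Hypothesis Nval : hp_valuation N.
Hypothesis Nshear : forall t, hp_covariant N 1 0 t 1.
Hypothesis Nswap : hp_covariant N 0 1 1 0.
Local Notation HP := (@halfplanes R).
Local Notation E := (quad_value N).
Local Notation g := (gfun N).

(** What a vertex [(p, 0)] adds to the first component, with the opposite sign on the left;
    [coef_snd] plays this role for the second component, with equal signs. *)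
Definition coef_fst c d p := g (p * c) / c + g (p * d) / d.
Definition coef_snd c d p := (g (p * c) - g (p * d)) / p.

Lemma E0_formula c d p p' : 0 < c -> 0 < d -> 0 < p -> 0 < p' ->
  E c d p 0 p' 0 = (coef_fst c d p - coef_fst c d p', coef_snd c d p + coef_snd c d p').
Proof.
move=> c0 d0 p0 p'0; rewrite [LHS]surjective_pairing (axis_value_snd Nswap)//.
rewrite -/(axis_value N p p' c d) !(axis_value_formula Nval Nshear Nswap)//.
by rewrite /coef_fst /coef_snd ![_ * p]mulrC ![_ * p']mulrC; congr pair; field; rewrite !gt_eqF.
Qed.

Lemma adm_small (c d p t p' : R) : 0 < c -> 0 < d -> 0 < p -> 0 < p' ->
  p' * `|t| <= Num.min c d -> adm c d p (p * t) p' 0.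
Proof.
move=> c0 d0 p0 p'0; rewrite le_min => /andP[h1 h2].
have t1 : p' * t <= p' * `|t| by rewrite ler_pM2l// ler_norm.
have t2 : p' * - t <= p' * `|t| by rewrite ler_pM2l// -normrN ler_norm.
have pc : 0 <= c * p' by rewrite mulr_ge0 ?ltW.
have pd : 0 <= d * p' by rewrite mulr_ge0 ?ltW.
have k1 : p * (p' * t) <= p * c by rewrite ler_pM2l//; lra.
have k2 : p * (p' * - t) <= p * d by rewrite ler_pM2l//; lra.
by apply/andP; split; lra.
Qed.

(** The two vertices lie on one line through the origin, so the crossing point is the origin. *)
Lemma adm_opp (c d p t p' : R) : 0 < c -> 0 < d -> 0 < p -> 0 < p' ->
  adm c d p (p * t) p' (- t * p').
Proof.
move=> c0 d0 p0 p'0; have := adm0 c0 d0 p0 p'0; rewrite /adm !mulr0 !addr0.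
by rewrite (_ : p' * _ + _ = 0)//; ring.
Qed.

(* With this abscissa for the second vertex, every first vertex of slope at most [`|t|] is admissible. *)
Definition small_abscissa (c d t : R) := Num.min c d / (1 + `|t|).

Lemma small_abscissa_gt0 (c d t : R) : 0 < c -> 0 < d -> 0 < small_abscissa c d t.
Proof. by move=> c0 d0; rewrite divr_gt0 ?lt_min ?c0//; have := normr_ge0 t; lra. Qed.

Lemma small_abscissa_small (c d t s : R) : 0 < c -> 0 < d -> `|s| <= 1 + `|t| ->
  small_abscissa c d t * `|s| <= Num.min c d.
Proof.
move=> c0 d0 st; have p0 : 0 < 1 + `|t| by have := normr_ge0 t; lra.
rewrite /small_abscissa mulrAC ler_pdivrMr// ler_wpM2l// ltW// lt_min c0//.
Qed.

(* The part of the dependence on the slope [t] that covariance alone leaves undetermined. *)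
Definition defect c d t := (E c d 1 t (small_abscissa c d t) 0).2 - t * coef_fst c d 1 - coef_snd c d 1 - coef_snd c d (small_abscissa c d t).

(** Splitting reduces the vertices to the reference pair [(1, t)], [(- r, 0)]: the auxiliary pairs
    [(u, u * t)], [(- r, - t * r)] are shears of pairs on the first axis, whose values are known. *)
Lemma E_slope c d p t p' : 0 < c -> 0 < d -> 0 < p -> 0 < p' -> adm c d p (p * t) p' 0 ->
  E c d p (p * t) p' 0 =
  (coef_fst c d p - coef_fst c d p', t * coef_fst c d p + coef_snd c d p + coef_snd c d p' + defect c d t).
Proof.
move=> c0 d0 p0 p'0 A.
set r := small_abscissa c d t; have r0 : 0 < r := small_abscissa_gt0 t c0 d0.
have tr : r * `|t| <= Num.min c d by apply: small_abscissa_small => //; rewrite lerDr.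
have step u u' : 0 < u -> 0 < u' -> adm c d u (u * t) u' 0 ->
  E c d u (u * t) u' 0 = add2 (E c d 1 t r 0)
    ((coef_fst c d u - coef_fst c d u') - (coef_fst c d 1 - coef_fst c d r),
     t * coef_fst c d u + coef_snd c d u + coef_snd c d u' - t * coef_fst c d 1 - coef_snd c d 1 - coef_snd c d r).
  move=> u0 u'0 Au.
  have := quad_val Nval c0 d0 u0 u'0 (@ltr01 R) r0 Au (adm0 c0 d0 ltr01 r0)
    (adm_small c0 d0 u0 r0 tr) (adm0 c0 d0 ltr01 u'0).
  have a1 : adm c d 1 t r 0 by rewrite -[t]mul1r; exact: adm_small.
  have a2 : adm c d 1 t r (- t * r) by rewrite -[X in adm _ _ _ X]mul1r; exact: adm_opp.
  have := quad_val Nval c0 d0 u0 r0 (@ltr01 R) r0 (adm_small c0 d0 u0 r0 tr) a2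
    (adm_opp t c0 d0 u0 r0) a1.
  have := E_shear Nshear t 0 0 c0 d0 u0 r0.
  have := E_shear Nshear t 0 0 c0 d0 (@ltr01 R) r0.
  rewrite !sub0r !add0r !mulr1 -mulNr [t * u]mulrC => -> ->.
  rewrite !E0_formula// /add2 /lin /= => -[h1 h2] -[h3 h4].
  rewrite [LHS]surjective_pairing; congr pair; lra.
(* When both abscissae are [r], the shear by [- t] gives the same quadrilateral as the reflection in
   the second axis; the shear fixes the first component of the value and the reflection negates
   it. *)
have E1 : (E c d 1 t r 0).1 = coef_fst c d 1 - coef_fst c d r.
  have Ar := adm_small c0 d0 r0 r0 tr.
  have := step _ _ r0 r0 Ar.
  have := E_shear Nshear (- t) (r * t) 0 c0 d0 r0 r0.
  rewrite (_ : r * t + - t * r = 0); last by ring.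
  rewrite (_ : 0 - - t * r = r * t); last by ring.
  rewrite (E_reflect1 Nshear Nswap (r * t) 0)// /lin /= => -[h1 _] h2.
  have : (E c d r (r * t) r 0).1 = 0 by lra.
  by rewrite h2 /=; lra.
rewrite step// /add2 /= E1 /defect -/r; congr pair; lra.
Qed.

(** Splitting compares right slopes [s + t] and [t] against the left vertices [(- r, 0)] and
    [(- r, - t * r)]; the shear by [t] produces the pairs with the second of these from slopes [s]
    and [0]. The abscissa [r] is small enough for all the slopes involved. *)
Lemma defect_add (c d s t : R) : 0 < c -> 0 < d ->
  defect c d (s + t) = defect c d s + defect c d t.
Proof.
move=> c0 d0; set r := small_abscissa c d (`|s| + `|t|).
have r0 : 0 < r := small_abscissa_gt0 _ c0 d0.
have n1 : `| `|s| + `|t| | = `|s| + `|t| by rewrite ger0_norm// addr_ge0.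
have s0 := normr_ge0 s; have t0 := normr_ge0 t.
have rs : r * `|s| <= Num.min c d by apply: small_abscissa_small => //; rewrite n1; lra.
have rt : r * `|t| <= Num.min c d by apply: small_abscissa_small => //; rewrite n1; lra.
have rst : r * `|s + t| <= Num.min c d.
  by apply: small_abscissa_small => //; rewrite n1; have := ler_normD s t; lra.
have as_ : adm c d 1 (1 * s) r 0 by exact: adm_small.
have at_ : adm c d 1 (1 * t) r 0 by exact: adm_small.
have ast_ : adm c d 1 (1 * (s + t)) r 0 by exact: adm_small.
have a1 : adm c d 1 (1 * t) r (- t * r) by exact: adm_opp.
have a2 : adm c d 1 (1 * (s + t)) r (- t * r).
  by move: as_ => /andP[h1 h2]; apply/andP; split; lra.
have := quad_val Nval c0 d0 (@ltr01 R) r0 (@ltr01 R) r0 ast_ a1 a2 at_.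
have := E_shear Nshear t 0 0 c0 d0 (@ltr01 R) r0.
have := E_shear Nshear t (1 * s) 0 c0 d0 (@ltr01 R) r0.
rewrite !sub0r !add0r !mulr1 -mulNr.
rewrite (_ : 1 * s + t = 1 * (s + t)); last by ring.
rewrite -[X in E c d 1 X r (- t * r) = lin 1 0 t 1 (E c d 1 0 _ _) -> _]mul1r.
move=> -> ->; rewrite !E_slope// !E0_formula// /add2 /lin /= => -[h1 h2].
lra.
Qed.

Lemma E_formula c d k : 0 < c -> 0 < d -> (forall t, defect c d t = k * t) ->
  forall p q p' q', 0 < p -> 0 < p' -> adm c d p q p' q' ->
  E c d p q p' q' = (coef_fst c d p - coef_fst c d p', coef_snd c d p + coef_snd c d p' +
    q / p * (coef_fst c d p + k) + q' / p' * (coef_fst c d p' + k)).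
Proof.
move=> c0 d0 hk p q p' q' p0 p'0 A.
(* Undoing the shear by this [t] puts the left vertex on the first axis and leaves slope [q / p - t]
   on the right. *)
set t := - (q' / p').
have e1 : q' = 0 - t * p' by rewrite /t; field; rewrite gt_eqF.
have e2 : q = p * (q / p - t) + t * p by rewrite /t; field; rewrite !gt_eqF.
have A' : adm c d p (p * (q / p - t)) p' 0.
  have e : p' * (p * (q / p - t)) + p * 0 = p' * q + p * q' by rewrite /t; field; rewrite !gt_eqF.
  by rewrite /adm e.
rewrite {1}e1 {1}e2 E_shear// E_slope// hk /lin /= /t; congr pair; first by ring.
by ring.
Qed.

End QuadFormula.

(** * The functional equation and vanishing on admissible quadrilaterals *)

Section QuadVanish.
Variable R : realType.
Notation pt := (R * R)%type.
Variable N : set pt -> pt.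
Hypothesis Nval : hp_valuation N.
Hypothesis Nshear : forall t, hp_covariant N 1 0 t 1.
Hypothesis Nswap : hp_covariant N 0 1 1 0.
Local Notation HP := (@halfplanes R).
Local Notation E := (quad_value N).
Local Notation g := (gfun N).
Hypothesis defect_linear : forall c d, 0 < c -> 0 < d ->
  exists k, forall t, defect N c d t = k * t.
Hypothesis axis_normalized : axis_value N 2 1 1 1 = 0.

Local Notation kap c d := (defect N c d 1).

Lemma E_kap c d p q p' q' : 0 < c -> 0 < d -> 0 < p -> 0 < p' -> adm c d p q p' q' ->
  E c d p q p' q' = (coef_fst N c d p - coef_fst N c d p', coef_snd N c d p + coef_snd N c d p' +
    q / p * (coef_fst N c d p + kap c d) + q' / p' * (coef_fst N c d p' + kap c d)).
Proof.
move=> c0 d0 p0 p'0 A; have [k hk] := defect_linear c0 d0.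
by rewrite (E_formula Nval Nshear Nswap c0 d0 hk)// hk mulr1.
Qed.

(* The triangle (p, 0), (-p', 1), (0, -1) is mapped to itself by the reflection that fixes (p, 0) and exchanges the other two vertices. *)
Lemma gfun_equation w t : 0 < w -> 0 < t ->
  t * (g (w + t) - g w) = (2 * w + t) * g t + w * kap (w / (w + t)) 1.
Proof.
move=> w0 t0; set s := w / (w + t).
have wt0 : 0 < w + t by rewrite addr_gt0.
have s0 : 0 < s by rewrite divr_gt0.
have s1 : s < 1 by rewrite ltr_pdivrMr//; lra.
(* These abscissae make the side from [(p, 0)] to [(- p', 1)] cross the axis at height [s], with
   [p * s = w] and [p' * s = t] as arguments of [g]. *)
set p := w + t; set p' := (w + t) * t / w.
have p'0 : 0 < p' by rewrite divr_gt0// mulr_gt0.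
have e1 : s * (p + p') = p by rewrite /s /p /p'; field; rewrite !gt_eqF.
have e2 : p' * s = t by rewrite /p' /s; field; rewrite !gt_eqF.
have e3 : p * s = w by rewrite /p /s; field; rewrite !gt_eqF.
have p0 : 0 < p by [].
have A : adm s 1 p 0 p' 1 by apply/andP; split; rewrite ?e1; lra.
have sym : lin 1 p' 0 (-1) (E s 1 p 0 p' 1) = E s 1 p 0 p' 1.
  rewrite /quad_value -(hp_covariant_detN1 Nshear Nswap); [|by ring|by apply: bquad].
  congr N; apply/seteqP; split => -[X Y];
    rewrite !halfplanes_cons /dot2 /= => -[a1 [a2 [a3 [a4 _]]]].
    have b' : (1 - s) * (p * X) <= 1 - s by rewrite -[leRHS]mulr1 ler_pM2l ?subr_gt0//; lra.
    split; [|by do !(split; try lra); exact: halfplanes_nil].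
    have b1 : s * (- p' * X + Y) <= s by rewrite -[leRHS]mulr1 ler_pM2l//; lra.
    have ee : s * p * X + s * p' * X = p * X by rewrite -[in RHS]e1; ring.
    lra.
  split; [|by do !(split; try lra); exact: halfplanes_nil].
  have b' : (1 - s) * (p * X) <= 1 - s by rewrite -[leRHS]mulr1 ler_pM2l ?subr_gt0//; lra.
  have b1 : s * (- Y) <= s by rewrite -[leRHS]mulr1 ler_pM2l//; lra.
  have ee : s * p * X + s * p' * X = p * X by rewrite -[in RHS]e1; ring.
  lra.
(* The reflection negates the second component of the value; in the resulting equation the two terms
   [g p'] cancel. *)
have E20 : (E s 1 p 0 p' 1).2 = 0 by move/(congr1 snd): sym; rewrite /lin /=; lra.
move: E20; rewrite E_kap//= /coef_fst /coef_snd e2 e3 !mulr1 !divr1 !mul0r addr0 /p'.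
have -> : (w + t) * t / w = p' by [].
rewrite -/p => h.
suff : p * t * ((g w - g p) / p + (g t - g p') / p' + 1 / p' * (g t / s + g p' + kap s 1)) = 0.
  rewrite /p' /s; have -> : p * t * ((g w - g p) / p + (g t - g ((w + t) * t / w)) / ((w + t) * t / w) +
    1 / ((w + t) * t / w) * (g t / (w / (w + t)) + g ((w + t) * t / w) + kap (w / (w + t)) 1))
    = t * (g w - g p) + w * g t + (w + t) * g t + w * kap (w / (w + t)) 1.
    by rewrite /p; field; rewrite !gt_eqF.
  by rewrite /p; lra.
by rewrite h mulr0.
Qed.

(** The [kap] term depends only on the ratio of the arguments, so comparing [gfun_equation] at
    [l * u], [l * v] with the one at [u], [v] removes it. Eliminating the value at the sum by means
    of both orders shows that [g (l * u) - g u] is proportional to [u ^+ 2]. With [g 1 = g 2 = 0],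
    [hom 2 w 1] gives [g (2 * w) = g w] while [hom w 2 1] gives [g (2 * w) = 4 * g w]. *)
Lemma gfun_eq0 w : 0 < w -> g w = 0.
Proof.
move=> w0.
have g1 : g 1 = 0.
  by have := axis_value_anti Nshear Nswap (@ltr01 R) ltr01 ltr01 ltr01; rewrite /gfun; lra.
have g2 : g 2 = 0 by rewrite /gfun axis_normalized mul0r.
have hom l u v : 0 < l -> 0 < u -> 0 < v ->
    v ^+ 2 * g (l * u) - u ^+ 2 * g (l * v) = v ^+ 2 * g u - u ^+ 2 * g v.
  move=> l0 u0 v0.
  have uv : 0 < u + v by rewrite addr_gt0.
  have r1 : (l * u) / (l * u + l * v) = u / (u + v) by rewrite -mulrDr -mulf_div divff ?gt_eqF// mul1r.
  have r2 : (l * v) / (l * v + l * u) = v / (u + v) by rewrite -mulrDr -mulf_div divff ?gt_eqF// mul1r addrC.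
  have := gfun_equation (mulr_gt0 l0 u0) (mulr_gt0 l0 v0).
  have := gfun_equation (mulr_gt0 l0 v0) (mulr_gt0 l0 u0).
  have := gfun_equation u0 v0; have := gfun_equation v0 u0.
  rewrite r1 r2 (addrC v u) (addrC (l * v)).
  set K1 := defect _ _ _ _; set K2 := defect _ _ _ _.
  move=> h1 h2 h3 h4.
  have k3 : u * (g (l * u + l * v) - g (l * v)) = (2 * v + u) * g (l * u) + v * K1.
    by apply: (mulfI (lt0r_neq0 l0)); lra.
  have k4 : v * (g (l * u + l * v) - g (l * u)) = (2 * u + v) * g (l * v) + u * K2.
    by apply: (mulfI (lt0r_neq0 l0)); lra.
  have := congr1 ( *%R u) k4; have := congr1 ( *%R v) k3.
  have := congr1 ( *%R v) h1; have := congr1 ( *%R u) h2.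
  lra.
have := hom 2 w 1 ltac:(lra) w0 ltac:(lra).
have := hom w 2 1 w0 ltac:(lra) ltac:(lra).
rewrite [w * 2]mulrC !mulr1 g1 g2 !expr1n; lra.
Qed.

Lemma kap_lt1 s : 0 < s -> s < 1 -> kap s 1 = 0.
Proof.
move=> s0 s1; have t0 : 0 < 1 - s by lra.
have := gfun_equation s0 t0; rewrite subrKC divr1 !gfun_eq0// => h.
by apply: (mulfI (lt0r_neq0 s0)); lra.
Qed.

Lemma coef_fst_eq0 c d p : 0 < c -> 0 < d -> 0 < p -> coef_fst N c d p = 0.
Proof. by move=> *; rewrite /coef_fst !gfun_eq0 ?mulr_gt0// !mul0r addr0. Qed.

Lemma coef_snd_eq0 c d p : 0 < c -> 0 < d -> 0 < p -> coef_snd N c d p = 0.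
Proof. by move=> *; rewrite /coef_snd !gfun_eq0 ?mulr_gt0// subrr mul0r. Qed.

Lemma E_kap0 c d p q p' q' : 0 < c -> 0 < d -> 0 < p -> 0 < p' -> adm c d p q p' q' ->
  kap c d = 0 -> E c d p q p' q' = (0, 0).
Proof.
move=> c0 d0 p0 p'0 A k0; rewrite E_kap// k0 !coef_fst_eq0// !coef_snd_eq0//.
by congr pair; ring.
Qed.

(** Equal poles are not reached by [gfun_equation], where [s < 1]. The triangle (1, 1), (-1, 1), (0,
    -1) has its upper pole on a side; a reflection exchanging (1, 1) and (0, -1) maps it to a
    triangle with poles at heights 1/3 and -1, where the value is known to vanish. *)
Lemma kap11 : kap 1 1 = 0.
Proof.
have A : adm 1 1 1 1 1 (1 : R) by apply/andP; split; lra.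
have A' : adm 3^-1 1 1 1 2 (-1 : R) by apply/andP; split; lra.
have t0 : 0 < 3^-1 :> R by lra.
have : lin 1 (-1) 0 (-1) (E 1 1 1 1 1 1) = E 3^-1 1 1 1 2 (-1).
  rewrite /quad_value -(hp_covariant_detN1 Nshear Nswap); [|by ring|by apply: bquad].
  congr N; apply/seteqP; split => -[X Y];
    rewrite !halfplanes_cons /dot2 /= => -[a1 [a2 [a3 [a4 _]]]];
    by do !(split; try lra); exact: halfplanes_nil.
rewrite (E_kap0 t0 _ _ _ A')//; [|by apply: kap_lt1; lra].
rewrite E_kap// !coef_fst_eq0// !coef_snd_eq0// /lin /= => -[_ h]; lra.
Qed.

(** A diagonal map brings the lower pole to (0, -1); a reflection arranges that the upper pole is
    not the farther one. *)
Lemma E_eq0 c d p q p' q' : 0 < c -> 0 < d -> 0 < p -> 0 < p' -> adm c d p q p' q' ->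
  E c d p q p' q' = (0, 0).
Proof.
have main c1 d1 p1 q1 p1' q1' : 0 < c1 -> 0 < d1 -> 0 < p1 -> 0 < p1' -> c1 <= d1 ->
    adm c1 d1 p1 q1 p1' q1' -> E c1 d1 p1 q1 p1' q1' = (0, 0).
  move=> c0 d0 p0 p'0 cd A.
  have cd0 : 0 < c1 / d1 by rewrite divr_gt0.
  have := E_diag Nshear Nswap q1 q1' d0 c0 d0 p0 p'0.
  rewrite mulfV ?gt_eqF// E_kap0 ?divr_gt0 ?mulr_gt0//; first last.
  - have [->|/eqP ne] := c1 / d1 =P 1; first exact: kap11.
    by apply: kap_lt1 => //; rewrite lt_neqAle ne ler_pdivrMr// mul1r.
  - case/andP: A => A1 A2.
    have f1 : d1 * p1' * (q1 / d1) + d1 * p1 * (q1' / d1) = p1' * q1 + p1 * q1'.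
      by field; rewrite gt_eqF.
    have f2 : c1 / d1 * (d1 * p1 + d1 * p1') = c1 * (p1 + p1') by field; rewrite gt_eqF.
    by rewrite /adm f1 f2; apply/andP; split => //; lra.
  rewrite /lin /= !mul0r addr0 add0r => -[h1 h2].
  rewrite [LHS]surjective_pairing; congr pair.
    by apply: (mulfI (lt0r_neq0 d0)); rewrite mulr0.
  by apply: (mulfI (_ : d1^-1 != 0)); rewrite ?mulr0// invr_eq0 gt_eqF.
move=> c0 d0 p0 p'0 A; have [cd|/ltW dc] := leP c d; first exact: main.
have A' : adm d c p (- q) p' (- q') by case/andP: A => *; apply/andP; split; lra.
have := main _ _ _ _ _ _ d0 c0 p0 p'0 dc A'.
rewrite (E_reflect2 Nshear Nswap)// /lin /= => -[h1 h2].
by rewrite [LHS]surjective_pairing; congr pair; lra.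
Qed.

End QuadVanish.

(** * Reduction of polygons to quadrilaterals *)

Section PolygonVanish.
Variable R : realType.
Notation pt := (R * R)%type.
Variable N : set pt -> pt.
Hypothesis Nval : hp_valuation N.
Hypothesis Nshear : forall t, hp_covariant N 1 0 t 1.
Hypothesis Nswap : hp_covariant N 0 1 1 0.
Local Notation HP := (@halfplanes R).
Local Notation E := (quad_value N).
Hypothesis E_vanish : forall c d p q p' q', 0 < c -> 0 < d -> 0 < p -> 0 < p' ->
  adm c d p q p' q' -> E c d p q p' q' = (0, 0).

Lemma crossing_le (p q p' q' X Y : R) : 0 < p -> 0 < p' ->
  p * X + q * Y <= 1 -> - p' * X + q' * Y <= 1 -> (p' * q + p * q') * Y <= p + p'.
Proof.
move=> p0 p'0 h1 h2.
have : p' * (p * X + q * Y) <= p' * 1 by rewrite ler_pM2l.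
have : p * (- p' * X + q' * Y) <= p * 1 by rewrite ler_pM2l.
lra.
Qed.

(** The point where the upper side crosses the axis can be added as a pole: its constraint is
    implied by those of the end points of the side. *)
Lemma triangle_down_quad (p q p' q' e : R) : 0 < p -> 0 < p' -> 0 < e ->
  0 < p' * q + p * q' -> exists2 s, 0 < s & adm s e p q p' q' /\
  HP [:: (p, q); (- p', q'); (0, - e)] = HP (quad s e p q p' q').
Proof.
move=> p0 p'0 e0 S0; have pp : 0 < p + p' by rewrite addr_gt0.
set s := (p' * q + p * q') / (p + p').
have hs : s * (p + p') = p' * q + p * q' by rewrite divfK// gt_eqF.
have s0 : 0 < s by rewrite divr_gt0.
exists s => //; split; first by have ? := mulr_gt0 e0 pp; by apply/andP; split; lra.
apply/seteqP; split => -[X Y];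
  rewrite !halfplanes_cons /dot2 /= => -[a1 [a2 [a3 a4]]]; last first.
  by do !(split; try lra); exact: halfplanes_nil.
have h1 : - p' * X + q' * Y <= 1 by lra.
have := crossing_le p0 p'0 a1 h1; rewrite -hs => h2.
split; last by do !(split; try lra); exact: halfplanes_nil.
by rewrite -(ler_pM2r pp); lra.
Qed.

Lemma triangle_up_quad (p q p' q' c : R) : 0 < p -> 0 < p' -> 0 < c ->
  p' * q + p * q' < 0 -> exists2 s, 0 < s & adm c s p q p' q' /\
  HP [:: (0, c); (p, q); (- p', q')] = HP (quad c s p q p' q').
Proof.
move=> p0 p'0 c0 S0; have pp : 0 < p + p' by rewrite addr_gt0.
set s := - (p' * q + p * q') / (p + p').
have hs : s * (p + p') = - (p' * q + p * q') by rewrite divfK// gt_eqF.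
have s0 : 0 < s by rewrite divr_gt0// oppr_gt0.
exists s => //; split; first by have ? := mulr_gt0 c0 pp; by apply/andP; split; lra.
apply/seteqP; split => -[X Y];
  rewrite !halfplanes_cons /dot2 /= => -[a1 [a2 [a3 a4]]]; last first.
  by do !(split; try lra); exact: halfplanes_nil.
have h1 : - p' * X + q' * Y <= 1 by lra.
have := crossing_le p0 p'0 a2 h1; rewrite -[_ + p * q']opprK -hs => h2.
split; first lra; split; last by do !(split; try lra); exact: halfplanes_nil.
by rewrite -(ler_pM2r pp); lra.
Qed.

Lemma triangle_vanish_down p q p' q' e : 0 < p -> 0 < p' -> 0 < e ->
  0 < p' * q + p * q' -> N (HP [:: (p, q); (- p', q'); (0, - e)]) = (0, 0).
Proof.
move=> p0 p'0 e0 S0; have [s s0 [A ->]] := triangle_down_quad p0 p'0 e0 S0.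
exact: E_vanish.
Qed.

Lemma triangle_vanish_up p q p' q' c : 0 < p -> 0 < p' -> 0 < c ->
  p' * q + p * q' < 0 -> N (HP [:: (0, c); (p, q); (- p', q')]) = (0, 0).
Proof.
move=> p0 p'0 c0 S0; have [s s0 [A ->]] := triangle_up_quad p0 p'0 c0 S0.
exact: E_vanish.
Qed.

(** If admissibility fails, the crossing point lies beyond one pole; that pole is then redundant and
    a triangle remains. *)
Lemma quad_vanish c d p q p' q' : 0 < c -> 0 < d -> 0 < p -> 0 < p' ->
  N (HP (quad c d p q p' q')) = (0, 0).
Proof.
move=> c0 d0 p0 p'0; have pp : 0 < p + p' by rewrite addr_gt0.
have [h1|h1] := leP (p' * q + p * q') (c * (p + p')); last first.
  rewrite -(@triangle_vanish_down p q p' q' d)//; last first.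
    by apply: lt_trans h1; rewrite mulr_gt0.
  congr N; apply/seteqP; split => -[X Y];
    rewrite !halfplanes_cons /dot2 /= => -[a1 [a2 [a3 a4]]].
    by do !(split; try lra); exact: halfplanes_nil.
  split; last by do !(split; try lra); exact: halfplanes_nil.
  have k1 : - p' * X + q' * Y <= 1 by lra.
  have k2 := crossing_le p0 p'0 a1 k1.
  have [Y0|/ltW Y0] := leP 0 Y.
    have k3 : c * (p + p') * Y <= (p' * q + p * q') * Y by rewrite ler_wpM2r// ltW.
    by rewrite -(ler_pM2r pp); lra.
  have : c * Y <= 0 by rewrite mulr_ge0_le0// ltW.
  lra.
have [h2|h2] := leP (- d * (p + p')) (p' * q + p * q').
  by apply: E_vanish => //; apply/andP; split.
rewrite -(@triangle_vanish_up p q p' q' c)//; last first.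
  by apply: lt_trans h2 _; rewrite mulNr oppr_lt0 mulr_gt0.
congr N; apply/seteqP; split => -[X Y];
  rewrite !halfplanes_cons /dot2 /= => -[a1 [a2 [a3 a4]]].
  by do !(split; try lra); exact: halfplanes_nil.
split; first lra; split; last by do !(split; try lra); exact: halfplanes_nil.
have k1 : - p' * X + q' * Y <= 1 by lra.
have k2 := crossing_le p0 p'0 a2 k1.
have [Y0|/ltW Y0] := leP 0 Y.
  have : - (d * Y) <= 0 by rewrite oppr_le0 mulr_ge0// ltW.
  lra.
have k3 : - d * (p + p') * Y <= (p' * q + p * q') * Y by rewrite ler_wnM2r// ltW.
by rewrite -(ler_pM2r pp); lra.
Qed.

Lemma seq_argmax (s : seq pt) (P : pt -> bool) (f : pt -> R) :
  (exists2 x, x \in s & P x) ->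
  exists x, [/\ x \in s, P x & forall y, y \in s -> P y -> f y <= f x].
Proof.
elim: s => [[]//|a s IH [x0 x0s Px0]].
have [/IH [x [xs Px hx]]|no] := pselect (exists2 x, x \in s & P x); last first.
  have no' y : y \in s -> P y -> False by move=> ys Py; apply: no; exists y.
  move: x0s; rewrite inE => /orP[/eqP x0a|/no' /(_ Px0) []//].
  rewrite x0a in Px0; exists a; split=> //; first exact: mem_head.
  by move=> y; rewrite inE => /orP[/eqP -> //|/no' h /h []].
have [fa|/ltW fa] := leP (f a) (f x).
  exists x; split=> //; first by rewrite inE xs orbT.
  by move=> y; rewrite inE => /orP[/eqP ->//|ys Py]; apply: hx.
have [Pa|Pa] := boolP (P a).
  exists a; split=> //; first by rewrite mem_head.
  by move=> y; rewrite inE => /orP[/eqP ->//|ys Py]; apply: le_trans (hx _ ys Py) fa.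
exists x; split=> //; first by rewrite inE xs orbT.
by move=> y; rewrite inE => /orP[/eqP ->|ys Py]; [move/negP: Pa|apply: hx].
Qed.

(** If no functional in [U] is positive at [z], the whole ray through [z] stays in the polygon. *)
Lemma sqbounded_ray U (z : pt) : sqbounded (HP U) ->
  (forall u, u \in U -> dot2 u z <= 0) -> z = (0, 0).
Proof.
move=> [r hr] h.
have inHP T : 0 <= T -> HP U (T * z.1, T * z.2).
  move=> T0 u uU; rewrite /dot2 /=.
  have -> : u.1 * (T * z.1) + u.2 * (T * z.2) = T * dot2 u z by rewrite /dot2; ring.
  by apply: le_trans (ler_wpM2l T0 (h u uU)) _; rewrite mulr0.
have r0 : 0 <= r by have [+ _] := hr _ (inHP 0 (lexx _)); apply: le_trans.
have z0 x : (forall T, 0 <= T -> `|T * x| <= r) -> x = 0.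
  move=> hx; apply/eqP/negPn/negP => x0.
  have nx : 0 < `|x| by rewrite normr_gt0.
  have T0 : 0 <= (r + 1) / `|x| by rewrite divr_ge0//; lra.
  have := hx _ T0; rewrite normrM (ger0_norm T0) divfK ?gt_eqF//; lra.
case: z {h} inHP => z1 z2 /= inHP.
by congr pair; apply: z0 => T /inHP /hr [].
Qed.

End PolygonVanish.

Section PolygonReduction.
Variable R : realType.
Notation pt := (R * R)%type.
Variable N : set pt -> pt.
Hypothesis Nval : hp_valuation N.
Hypothesis Nshear : forall t, hp_covariant N 1 0 t 1.
Hypothesis Nswap : hp_covariant N 0 1 1 0.
Local Notation HP := (@halfplanes R).
Local Notation E := (quad_value N).
Hypothesis E_vanish : forall c d p q p' q', 0 < c -> 0 < d -> 0 < p -> 0 < p' ->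
  adm c d p q p' q' -> E c d p q p' q' = (0, 0).

Lemma sqbounded_right U : sqbounded (HP U) -> exists2 u, u \in U & 0 < u.1.
Proof.
move=> bU; apply: contrapT => h.
suff /(sqbounded_ray bU) [/eqP] : forall u, u \in U -> dot2 u (1, 0) <= 0.
  by rewrite oner_eq0.
move=> u uU; rewrite /dot2 /= mulr1 mulr0 addr0 leNgt; apply/negP => u0.
by apply: h; exists u.
Qed.

Lemma sqbounded_left U : sqbounded (HP U) -> exists2 u, u \in U & u.1 < 0.
Proof.
move=> bU; apply: contrapT => h.
suff /(sqbounded_ray bU) [/eqP] : forall u, u \in U -> dot2 u (-1, 0) <= 0.
  by rewrite oppr_eq0 oner_eq0.
move=> u uU; rewrite /dot2 /= mulrN1 mulr0 addr0 oppr_le0 leNgt; apply/negP => u0.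
by apply: h; exists u.
Qed.

(* Steinitz's theorem in the plane, for a point on the positive second axis. *)
Lemma Steinitz_vanish U : (0, 1) \in U -> sqbounded (HP U) ->
  exists W, [/\ {subset W <= U}, sqbounded (HP W) & N (HP W) = (0, 0)].
Proof.
move=> vU bU.
(* The vertex of least slope on the right is the best partner for crossing the axis below the
   origin. *)
have [[p q] [xU /= p0 hx]] := seq_argmax (fun u => - (u.2 / u.1)) (sqbounded_right bU).
have [[axis axisU [/= axis1 axis2]]|noaxis] :=
    pselect (exists2 u, u \in U & u.1 = 0 /\ u.2 < 0).
  have [[a b] yU /= a0] := sqbounded_left bU.
  have bW : HP [:: (0, 1); axis; (p, q); (a, b)] = HP (quad 1 (- axis.2) p q (- a) b).
    by rewrite /quad !opprK; congr (HP [:: _; _; _; _]); case: axis axis1 {axisU axis2} => ? ? /= ->.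
  exists [:: (0, 1); axis; (p, q); (a, b)]; rewrite bW; split.
  - by move=> u; rewrite !inE => /or4P[]/eqP->.
  - by apply: bquad; rewrite ?oppr_gt0.
  - by apply: quad_vanish; rewrite ?oppr_gt0.
have [[[a b] yU /= [a0 hS]]|nocross] :=
    pselect (exists2 u, u \in U & u.1 < 0 /\ - u.1 * q + p * u.2 < 0).
  have a0' : 0 < - a by rewrite oppr_gt0.
  have [s s0 [A eW]] := triangle_up_quad p0 a0' ltr01 hS.
  rewrite opprK in eW.
  exists [:: (0, 1); (p, q); (a, b)]; rewrite eW; split.
  - by move=> u; rewrite !inE => /or3P[]/eqP->.
  - exact: bquad.
  - exact: E_vanish.
(* Without a suitable partner, all of [U] lies on one side of the line through the origin and
   [(p, q)]. *)
suff /(sqbounded_ray bU) [_ /eqP] : forall u, u \in U -> dot2 u (q, - p) <= 0.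
  by rewrite oppr_eq0 gt_eqF.
move=> [a b] uU; rewrite /dot2 /=.
have [a0|a0|a0] := ltgtP a 0.
- have : 0 <= - a * q + p * b.
    by rewrite leNgt; apply/negP => h; apply: nocross; exists (a, b).
  lra.
- have := hx _ uU a0 => /=; rewrite lerN2 ler_pdivrMr// mulrAC ler_pdivlMr//; lra.
- have : 0 <= b by rewrite leNgt; apply/negP => h; apply: noaxis; exists (a, b).
  by rewrite a0 mul0r add0r mulrN oppr_le0 => b0; rewrite mulr_ge0// ltW.
Qed.

Section Wedge.
Variables p q p' q' : R.
Hypotheses (p0 : 0 < p) (p'0 : 0 < p').
Let S := p' * q + p * q'.
Let P := p + p'.

(** The line through [(p, q)] and [(- p', q')] has height [(S + a * (q - q')) / P] over [a]. The
    hypotheses thus place [(a, b)] in the triangle formed with (0, 1). *)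
Lemma wedge_redundant a b X Y : 0 <= a -> a <= p -> (b - 1) * p <= (q - 1) * a ->
  S + a * (q - q') <= b * P -> Y <= 1 -> p * X + q * Y <= 1 -> - p' * X + q' * Y <= 1 ->
  a * X + b * Y <= 1.
Proof.
move=> a0 ap slope above Y1 hx hy; have P0 : 0 < P by rewrite addr_gt0.
have [Y0|/ltW Y0] := leP 0 Y.
  rewrite -(ler_pM2l p0).
  have : (b - 1) * p * Y <= (q - 1) * a * Y by rewrite ler_wpM2r.
  have : (p - a) * Y <= (p - a) * 1 by rewrite ler_wpM2l// subr_ge0.
  have : a * (p * X + q * Y) <= a * 1 by rewrite ler_wpM2l.
  lra.
rewrite -(ler_pM2l P0).
have : b * P * Y <= (S + a * (q - q')) * Y by rewrite ler_wnM2r.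
have : (p - a) * (- p' * X + q' * Y) <= (p - a) * 1 by rewrite ler_wpM2l// subr_ge0.
have : (a + p') * (p * X + q * Y) <= (a + p') * 1 by rewrite ler_wpM2l// addr_ge0// ltW.
rewrite /S /P; lra.
Qed.

(** Beyond [(p, q)] the line from (0, 1) through [(p, q)] runs no higher than the line joining the
    two neighbours. *)
Lemma wedge_below a b : S <= P -> p <= a -> (b - 1) * p <= (q - 1) * a ->
  b * P <= S + a * (q - q').
Proof.
move=> SP pa slope; have P0 : 0 < P by rewrite addr_gt0.
rewrite -(ler_pM2l p0).
have : 0 <= (a - p) * (P - S) by rewrite mulr_ge0// subr_ge0.
have : P * ((b - 1) * p) <= P * ((q - 1) * a) by rewrite ler_pM2l.
rewrite /S /P; lra.
Qed.

(** For [a < p] the point [(a, b)] is under the segment of the neighbours. For [a >= p] it is under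
    the ray from (0, 1) through [(p, q)], where (0, 1) has weight at most 0, so [1 < Y] helps. *)
Lemma wedge_above a b X Y : 0 <= a -> (b - 1) * p <= (q - 1) * a ->
  b * P <= S + a * (q - q') -> 1 < Y -> p * X + q * Y <= 1 -> - p' * X + q' * Y <= 1 ->
  a * X + b * Y <= 1.
Proof.
move=> a0 slope below Y1 hx hy; have P0 : 0 < P by rewrite addr_gt0.
have Y0 : 0 <= Y by lra.
have [ap|/ltW pa] := leP a p.
  rewrite -(ler_pM2l P0).
  have : b * P * Y <= (S + a * (q - q')) * Y by rewrite ler_wpM2r.
  have : (p - a) * (- p' * X + q' * Y) <= (p - a) * 1 by rewrite ler_wpM2l// subr_ge0.
  have : (a + p') * (p * X + q * Y) <= (a + p') * 1 by rewrite ler_wpM2l// addr_ge0// ltW.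
  rewrite /S /P; lra.
rewrite -(ler_pM2l p0).
have : (b - 1) * p * Y <= (q - 1) * a * Y by rewrite ler_wpM2r.
have : (p - a) * Y <= (p - a) * 1 by rewrite ler_wnM2l ?subr_le0// ltW.
have : a * (p * X + q * Y) <= a * 1 by rewrite ler_wpM2l.
lra.
Qed.

End Wedge.
End PolygonReduction.

(** * Removal of a vertex and induction on the number of constraints *)

Section PolygonInduction.
Variable R : realType.
Notation pt := (R * R)%type.
Variable N : set pt -> pt.
Hypothesis Nval : hp_valuation N.
Hypothesis Nshear : forall t, hp_covariant N 1 0 t 1.
Hypothesis Nswap : hp_covariant N 0 1 1 0.
Local Notation HP := (@halfplanes R).
Local Notation E := (quad_value N).
Hypothesis E_vanish : forall c d p q p' q', 0 < c -> 0 < d -> 0 < p -> 0 < p' ->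
  adm c d p q p' q' -> E c d p q p' q' = (0, 0).

Definition redundant U (u : pt) := HP (rem u U) `<=` HP [:: u].

Lemma halfplanes_rem U (u : pt) : u \in U -> HP U = HP (u :: rem u U).
Proof.
move=> uU; apply/seteqP; split; apply: sub_halfplanes => v;
  by rewrite (perm_mem (perm_to_rem uU)).
Qed.

Lemma halfplanes_redundant U (u : pt) : u \in U -> redundant U u -> HP U = HP (rem u U).
Proof.
move=> uU ru; rewrite (halfplanes_rem uU); apply/seteqP; split => z.
  by move=> /halfplanes_cons[].
by move=> zU; apply/halfplanes_cons; split=> //; apply: (ru _ zU); rewrite mem_head.
Qed.

Lemma mem_rem_neq (U : seq pt) u v : u \in U -> u != v -> u \in rem v U.
Proof.
move=> uU uv; have [vU|vU] := boolP (v \in U); last by rewrite rem_id.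
by move: uU; rewrite (perm_mem (perm_to_rem vU)) inE (negbTE uv).
Qed.

Lemma not_redundant (U : seq pt) u v x y : u \in U -> v \in U -> x \in U -> y \in U ->
  u != v -> u != x -> u != y -> ~ redundant U u ->
  ~ (forall X Y, dot2 v (X, Y) <= 1 -> dot2 x (X, Y) <= 1 -> dot2 y (X, Y) <= 1 ->
     dot2 u (X, Y) <= 1).
Proof.
move=> uU vU xU yU uv ux uy nr h; apply: nr => -[X Y] z w.
rewrite inE => /eqP ->; apply: h; apply: z; apply: mem_rem_neq => //; by rewrite eq_sym.
Qed.

Lemma remove_vertex U : (0, 1) \in U -> sqbounded (HP (rem (0, 1) U)) ->
  (forall u, u \in U -> ~ redundant U u) -> N (HP U) = N (HP (rem (0, 1) U)).
Proof.
move=> vU bU' nr; set U' := rem (0, 1) U.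
have sU' u : u \in U' -> u \in U by apply: mem_rem.
have vU' : (0, 1) \notin U'.
  by apply/negP => v'; apply: (nr _ vU) => z zU w; rewrite inE => /eqP ->; exact: zU.
have nv u : u \in U' -> u != (0, 1) by apply: contraTneq => ->.
(* The neighbours of (0, 1) are the points of steepest slope as seen from it, one on each side. *)
have [[p q] [xU /= p0 hx]] := seq_argmax (fun u => (u.2 - 1) / u.1) (sqbounded_right bU').
have [[a' q'] [yU /= a'0 hy]] := seq_argmax (fun u => (u.2 - 1) / - u.1) (sqbounded_left bU').
set p' := - a' in hy; have p'0 : 0 < p' by rewrite oppr_gt0.
have ea' : a' = - p' by rewrite opprK.
have slope1 a b : (a, b) \in U' -> 0 < a -> (b - 1) * p <= (q - 1) * a.
  by move=> uU a0; have := hx _ uU a0; rewrite /= ler_pdivrMr// mulrAC ler_pdivlMr.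
have slope2 a b : (a, b) \in U' -> a < 0 -> (b - 1) * p' <= (q' - 1) * - a.
  move=> uU a0; have := hy _ uU a0.
  by rewrite /= ler_pdivrMr ?oppr_gt0// mulrAC ler_pdivlMr.
have slope0 b : (0, b) \in U' -> b <= 1.
  move=> uU; rewrite leNgt; apply/negP => b1; apply: (nr _ vU) => -[X Y] /(_ _ uU).
  move=> h w; rewrite inE => /eqP ->; move: h; rewrite /dot2 /= => h.
  rewrite leNgt; apply/negP => Y1.
  have : b * 1 < b * Y by rewrite ltr_pM2l; lra.
  lra.
set S := p' * q + p * q'; set P := p + p'.
have P0 : 0 < P by rewrite addr_gt0.
(* Otherwise the segment of the neighbours crosses the axis above (0, 1), which would be
   redundant. *)
have SP : S <= P.
  rewrite leNgt; apply/negP => SP; apply: (nr _ vU) => -[X Y] h w; rewrite inE => /eqP ->.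
  have := h _ xU; have := h _ yU; rewrite /dot2 /= ea' => k1 k2.
  have := crossing_le p0 p'0 k2 k1; rewrite -/S -/P => k3.
  rewrite leNgt; apply/negP => Y1.
  have : P * Y < S * Y by rewrite ltr_pM2r//; lra.
  have : P * 1 < P * Y by rewrite ltr_pM2l//; lra.
  lra.
have SE : p * q' + p' * q = S by rewrite addrC.
have PE : p' + p = P by rewrite addrC.
(* A point above the line of the neighbours would lie in their triangle with (0, 1) and be
   redundant; beyond a neighbour, [wedge_below] excludes it. *)
have below a b : (a, b) \in U' -> b * P <= S + a * (q - q').
  move=> uU; rewrite leNgt; apply/negP => above.
  have [a0|a0] := leP 0 a.
    have sl : (b - 1) * p <= (q - 1) * a.
      move: a0; rewrite le_eqVlt => /orP[/eqP a0|/(slope1 _ _ uU) -> //].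
      have b1 : b <= 1 by apply: slope0; rewrite a0.
      by rewrite -a0 mulr0 mulr_le0_ge0// ?(ltW p0)// subr_le0.
    have [pa|ap] := leP p a.
      by have := wedge_below p0 p'0 SP pa sl; rewrite leNgt above.
    apply: (@not_redundant U (a, b) (0, 1) (p, q) (a', q')); rewrite ?(sU' _ uU) ?(sU' _ xU) ?(sU' _ yU) ?nv//.
    - by rewrite xpair_eqE negb_and lt_eqF.
    - by rewrite xpair_eqE negb_and gt_eqF// (lt_le_trans a'0).
    - by apply: nr; exact: sU'.
    move=> X Y; rewrite /dot2 /= ea' => h1 h2 h3.
    by apply: (wedge_redundant p0 p'0 a0 (ltW ap) sl (ltW above)) => //; lra.
  have na0 : 0 <= - a by rewrite oppr_ge0 ltW.
  have sl := slope2 _ _ uU a0.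
  have [pa|ap] := leP p' (- a).
    have SP' : p * q' + p' * q <= p' + p by rewrite SE PE.
    by have := wedge_below p'0 p0 SP' pa sl; rewrite SE PE; lra.
  have ab : p * q' + p' * q + - a * (q' - q) <= b * (p' + p) by rewrite SE PE; lra.
  apply: (@not_redundant U (a, b) (0, 1) (p, q) (a', q')); rewrite ?(sU' _ uU) ?(sU' _ xU) ?(sU' _ yU) ?nv//.
  - by rewrite xpair_eqE negb_and lt_eqF// (lt_trans a0).
  - by rewrite xpair_eqE negb_and gt_eqF// ea' ltrNl.
  - by apply: nr; exact: sU'.
  move=> X Y; rewrite /dot2 /= ea' => h1 h2 h3.
  have -> : a * X = - a * - X by ring.
  by apply: (wedge_redundant p'0 p0 na0 (ltW ap) sl ab) => //; lra.
(* Otherwise [U'] lies below a line that does not pass above the origin, and [HP U'] contains a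
   ray. *)
have S0 : 0 < S.
  rewrite ltNge; apply/negP => S0.
  suff /(sqbounded_ray bU') [_ /eqP] : forall u, u \in U' -> dot2 u (q' - q, P) <= 0.
    by rewrite gt_eqF.
  by move=> [a b] uU; have := below _ _ uU; rewrite /dot2 /=; lra.
have above a b X Y : (a, b) \in U' -> 1 < Y -> p * X + q * Y <= 1 ->
    - p' * X + q' * Y <= 1 -> a * X + b * Y <= 1.
  move=> uU Y1 h1 h2; have bel := below _ _ uU.
  have [a0|a0] := leP 0 a.
    have sl : (b - 1) * p <= (q - 1) * a.
      move: a0; rewrite le_eqVlt => /orP[/eqP a0|/(slope1 _ _ uU) -> //].
      have b1 : b <= 1 by apply: slope0; rewrite a0.
      by rewrite -a0 mulr0 mulr_le0_ge0// ?(ltW p0)// subr_le0.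
    exact: (wedge_above p0 p'0 a0 sl bel Y1).
  have -> : a * X = - a * - X by ring.
  have na0 : 0 <= - a by rewrite oppr_ge0 ltW.
  have bel' : b * (p' + p) <= p * q' + p' * q + - a * (q' - q) by rewrite SE PE; lra.
  by apply: (wedge_above p'0 p0 na0 (slope2 _ _ uU a0) bel' Y1); lra.
have [r hr] := bU'.
have r0 : 0 <= r.
  have [+ _] := hr (0, 0) ltac:(by move=> u _; rewrite /dot2 !mulr0 addr0).
  exact: le_trans.
(* So small that the constraint of [(0, - e)] already holds on [HP U']. *)
set e := (r + 1)^-1; have e0 : 0 < e by rewrite invr_gt0; lra.
have eU z : HP U' z -> - e * z.2 <= 1.
  move=> /hr [_ h]; rewrite mulNr -mulrN mulrC ler_pdivrMr ?mul1r; last lra.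
  have : - z.2 <= `|z.2| by rewrite -normrN ler_norm.
  lra.
set V := quad 1 e p q p' q'.
set W := [:: (p, q); (- p', q'); (0, - e)].
have [s s0 [A eW]] := triangle_down_quad p0 p'0 e0 S0.
have bW : sqbounded (HP W) by rewrite eW; exact: bquad.
have bV : sqbounded (HP V) by exact: bquad.
(* Cut at height 1: below it a point of [HP W] satisfies the constraint of (0, 1) and lies in
   [HP V]; above it the neighbours imply all other constraints of [U']. *)
have UVW : HP U' `|` HP V = HP W.
  apply/seteqP; split => -[X Y].
    case=> [h|].
      have := h _ xU; have := h _ yU; have := eU _ h.
      rewrite !halfplanes_cons /dot2 /= ea' => h1 h2 h3; clear -h1 h2 h3.
      by do !(split; try lra); exact: halfplanes_nil.
    rewrite !halfplanes_cons /dot2 /= => -[h1 [h2 [h3 [h4 _]]]]; clear -h2 h3 h4.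
    by do !(split; try lra); exact: halfplanes_nil.
  rewrite !halfplanes_cons /dot2 /= => -[h1 [h2 [h3 _]]].
  have [Y1|Y1] := leP Y 1; last by left=> -[a b] uU; exact: above.
  by right; rewrite !halfplanes_cons /dot2 /=; clear -h1 h2 h3 Y1; do !(split; try lra); exact: halfplanes_nil.
have := Nval bU' bV bW UVW.
have NW : N (HP W) = (0, 0) by rewrite eW; exact: E_vanish.
rewrite NW (quad_vanish E_vanish)//.
have -> : HP (U' ++ V) = HP U.
  rewrite (halfplanes_rem vU) -/U' halfplanes_cat; apply/seteqP; split => -[X Y].
    by move=> [h]; rewrite !halfplanes_cons => -[h1 _].
  move=> /halfplanes_cons[h1 h]; split=> //.
  have := h _ xU; have := h _ yU; have := eU _ h; move: h1.
  rewrite !halfplanes_cons /dot2 /= ea' => h1 h2 h3 h4; clear -h1 h2 h3 h4.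
  by do !(split; try lra); exact: halfplanes_nil.
rewrite /add2 /= => -[k1 k2].
by rewrite [LHS]surjective_pairing [RHS]surjective_pairing; congr pair; lra.
Qed.

Lemma straighten (v : pt) : v != (0, 0) ->
  exists a b c d : R, a * d - b * c = 1 /\ lin a b c d v = (0, 1).
Proof.
case: v => x y v0; have n0 : x ^+ 2 + y ^+ 2 != 0.
  by rewrite paddr_eq0 ?sqr_ge0// !sqrf_eq0; move: v0; rewrite xpair_eqE.
exists y, (- x), (x / (x ^+ 2 + y ^+ 2)), (y / (x ^+ 2 + y ^+ 2)).
by split; [field|rewrite /lin /=; congr pair; field].
Qed.

Lemma linK (a b c d : R) : a * d - b * c = 1 ->
  cancel (lin a b c d) (lin d (- b) (- c) a).
Proof.
move=> D1 [x y]; rewrite lin_comp.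
have -> : d * a + - b * c = 1 by lra.
have -> : d * b + - b * d = 0 by ring.
have -> : - c * a + a * c = 0 by ring.
have -> : - c * b + a * d = 1 by lra.
by rewrite /lin /= !mul0r !mul1r addr0 add0r.
Qed.

Lemma lin_vanish a b c d U : a * d - b * c = 1 -> sqbounded (HP U) ->
  N (HP (map (lin a b c d) U)) = (0, 0) -> N (HP U) = (0, 0).
Proof.
move=> D1 bU; rewrite (hp_covariant_det1 Nshear Nswap D1 bU) => h.
by rewrite -[LHS](linK D1) h /lin /= !mulr0 addr0.
Qed.

Theorem polygon_vanish U : sqbounded (HP U) -> N (HP U) = (0, 0).
Proof.
have [n] := ubnP (size U); elim: n U => // n IH U; rewrite ltnS => szU bU.
have dets (a b c d : R) : a * d - b * c = 1 -> a * d - b * c != 0.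
  by move=> ->; rewrite oner_eq0.
have [v vU v0] : exists2 v, v \in U & v != (0, 0).
  have [v vU v1] := sqbounded_right bU; exists v => //.
  by apply: contraTneq v1 => ->; rewrite ltxx.
have [a [b [c [d [D1 ev]]]]] := straighten v0.
apply: (lin_vanish D1 bU).
have {bU} := sqbounded_lin (dets _ _ _ _ D1) bU.
have {szU} := szU; rewrite -(size_map (lin a b c d)).
have {vU} : (0, 1) \in map (lin a b c d) U by rewrite -ev map_f.
move: (map _ U) => {}U {v v0 a b c d D1 ev} vU szU bU.
have IHr (u : pt) : u \in U -> redundant U u -> N (HP U) = (0, 0).
  move=> uU ru; rewrite (halfplanes_redundant uU ru); apply: IH.
    by rewrite size_rem// prednK//; case: (U) uU.
  by rewrite -(halfplanes_redundant uU ru).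
have [W [WU bW NW]] := Steinitz_vanish E_vanish vU bU.
have [UW|] := pselect {subset U <= W}.
  rewrite (_ : HP U = HP W)//.
  by apply/seteqP; split; exact: sub_halfplanes.
move=> /existsNP [v /not_implyP [{}vU vW]].
have [v0|v0] := eqVneq v (0, 0).
  apply: (IHr _ vU) => z _ w; rewrite inE v0 => /eqP ->.
  by rewrite /dot2 /= !mul0r addr0.
have [a [b [c [d [D1 ev]]]]] := straighten v0.
have bW' := sqbounded_lin (dets _ _ _ _ D1) bW.
apply: (lin_vanish D1 bU).
have [[u uU ru]|nr] := pselect (exists2 u, u \in map (lin a b c d) U & redundant (map (lin a b c d) U) u).
  rewrite (halfplanes_redundant uU ru); apply: IH.
    by rewrite size_rem// prednK ?size_map//; case: (U) uU.
  by rewrite -(halfplanes_redundant uU ru); exact: sqbounded_lin (dets _ _ _ _ D1) bU.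
have vU' : (0, 1) \in map (lin a b c d) U by rewrite -ev map_f.
have inj : injective (lin a b c d) := can_inj (linK D1).
have bU' : sqbounded (HP (rem (0, 1) (map (lin a b c d) U))).
  apply: sub_sqbounded bW'; apply: sub_halfplanes => w /mapP[u uW ->].
  apply: mem_rem_neq; first by rewrite map_f// WU.
  by rewrite -ev (inj_eq inj); apply: contraTneq uW => ->; exact/negP.
rewrite remove_vertex//; last by move=> u uU ru; apply: nr; exists u.
by apply: IH => //; rewrite size_rem// prednK ?size_map//; case: (U) vU'.
Qed.

End PolygonInduction.

(** * Minkowski-Weyl duality in the plane *)

Section MinkowskiWeyl.
Variable R : realType.
Notation pt := (R * R)%type.
Local Notation HP := (@halfplanes R).
Implicit Types (U V W : seq pt) (x y u v : pt).

Definition mix (t : R) x y : pt := ((1 - t) * x.1 + t * y.1, (1 - t) * x.2 + t * y.2).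

Lemma dot2_mix t x y u : dot2 u (mix t x y) = (1 - t) * dot2 u x + t * dot2 u y.
Proof. by rewrite /dot2 /mix /=; ring. Qed.

Lemma mix_dot2 t x y u : dot2 (mix t x y) u = (1 - t) * dot2 x u + t * dot2 y u.
Proof. by rewrite /dot2 /mix /=; ring. Qed.

Lemma convex_le1 (t a b : R) : 0 <= t <= 1 -> a <= 1 -> b <= 1 -> (1 - t) * a + t * b <= 1.
Proof.
move=> /andP[t0 t1] a1 b1.
have : (1 - t) * a <= (1 - t) * 1 by rewrite ler_wpM2l// subr_ge0.
have : t * b <= t * 1 by rewrite ler_wpM2l.
lra.
Qed.

Lemma halfplanes_convex U t x y : 0 <= t <= 1 -> HP U x -> HP U y -> HP U (mix t x y).
Proof. by move=> t01 hx hy u uU; rewrite dot2_mix; apply: convex_le1; [|exact: hx|exact: hy]. Qed.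

Lemma halfplanes0 U : HP U (0, 0).
Proof. by move=> u _; rewrite /dot2 !mulr0 addr0 ler01. Qed.

(* Fourier-Motzkin elimination of the parameter [t]: the constraint [u] with [dot2 u p > 1] bounds [t] from below and the other ones bound it from above. *)
Definition cone_constraints (p : pt) U :=
  [seq u <- U | dot2 u p <= 1] ++
  [seq mix ((dot2 u p - 1) / (dot2 u p - dot2 v p)) u v |
     u <- [seq u <- U | 1 < dot2 u p], v <- [seq v <- U | dot2 v p <= 1]].

(** The mixing coefficient makes the new functional equal to 1 at [p]. Conversely, the mixed
    constraints say that each lower bound for [t] is at most each upper one. *)
Lemma halfplanes_cone p U : sqbounded (HP U) ->
  HP (cone_constraints p U) =
  [set x | exists t, 0 <= t <= 1 /\ exists2 y, HP U y & x = mix t y p].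
Proof.
move=> bU; apply/seteqP; split => x /=; last first.
  move=> [t [t01 [y yU ->]]] w; rewrite mem_cat => /orP[|/allpairsP[[u v] /= []]].
    rewrite mem_filter => /andP[wp wU]; rewrite dot2_mix.
    by apply: convex_le1 => //; exact: yU.
  rewrite !mem_filter => /andP[up uU] /andP[vp vU] ->.
  have uv : 0 < dot2 u p - dot2 v p by lra.
  set s := (_ - 1) / _; rewrite dot2_mix; apply: convex_le1 => //; rewrite mix_dot2.
    apply: convex_le1; [|exact: yU|exact: yU].
    apply/andP; split; last by rewrite /s ler_pdivrMr//; lra.
    by rewrite /s divr_ge0//; lra.
  have -> : (1 - s) * dot2 u p + s * dot2 v p = dot2 u p - s * (dot2 u p - dot2 v p) by ring.
  by rewrite divfK ?gt_eqF//; lra.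
rewrite halfplanes_cat => -[h1 h2].
have h1' u : u \in U -> dot2 u p <= 1 -> dot2 u x <= 1.
  by move=> uU up; apply: h1; rewrite mem_filter up.
have h2' u v : u \in U -> v \in U -> 1 < dot2 u p -> dot2 v p <= 1 ->
    (1 - dot2 v p) * (dot2 u x - 1) <= (dot2 u p - 1) * (1 - dot2 v x).
  move=> uU vU up vp.
  have uv : 0 < dot2 u p - dot2 v p by lra.
  have m1 : u \in [seq u <- U | 1 < dot2 u p] by rewrite mem_filter up.
  have m2 : v \in [seq v <- U | dot2 v p <= 1] by rewrite mem_filter vp.
  have := h2 _ (allpairs_f (fun u v => mix ((dot2 u p - 1) / (dot2 u p - dot2 v p)) u v) m1 m2).
  rewrite mix_dot2; set s := (_ - 1) / _ => h.
  have es : s * (dot2 u p - dot2 v p) = dot2 u p - 1 by rewrite divfK// gt_eqF.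
  have : (dot2 u p - dot2 v p) * ((1 - s) * dot2 u x + s * dot2 v x) <= (dot2 u p - dot2 v p) * 1.
    by rewrite ler_pM2l.
  have -> : (dot2 u p - dot2 v p) * ((1 - s) * dot2 u x + s * dot2 v x) =
    (dot2 u p - dot2 v p - s * (dot2 u p - dot2 v p)) * dot2 u x + s * (dot2 u p - dot2 v p) * dot2 v x.
    by ring.
  rewrite es; lra.
(* The largest lower bound, or 0 if it is negative or absent. *)
have [t [t0 ht]] : exists t, 0 <= t /\
    forall u, u \in U -> dot2 u x - t * dot2 u p <= 1 - t.
  have [/(seq_argmax (fun u => (dot2 u x - 1) / (dot2 u p - 1)))|no] :=
      pselect (exists2 u, u \in U & 1 < dot2 u p); last first.
    exists 0; split=> // u uU; rewrite mul0r !subr0; apply: h1' => //.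
    by rewrite leNgt; apply/negP => up; apply: no; exists u.
  move=> [u0 [u0U u0p hu0]].
  set s := (dot2 u0 x - 1) / (dot2 u0 p - 1) in hu0.
  have es : s * (dot2 u0 p - 1) = dot2 u0 x - 1 by rewrite divfK// gt_eqF// subr_gt0.
  have hs u : u \in U -> 1 < dot2 u p -> dot2 u x - 1 <= s * (dot2 u p - 1).
    by move=> uU up; have := hu0 _ uU up; rewrite ler_pdivrMr// subr_gt0.
  have [s0|/ltW s0] := leP 0 s.
    exists s; split=> // u uU; have [up|up] := leP (dot2 u p) 1; last first.
      by have := hs _ uU up; lra.
    have := h2' _ _ u0U uU u0p up; rewrite -es.
    rewrite mulrA mulrC ler_pM2l ?subr_gt0//; lra.
  exists 0; split=> // u uU; rewrite mul0r !subr0.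
  have [up|up] := leP (dot2 u p) 1; first exact: h1'.
  have := hs _ uU up; have : s * (dot2 u p - 1) <= 0.
    by rewrite mulr_le0_ge0// subr_ge0 ltW.
  lra.
have dz u : dot2 u (x.1 - t * p.1, x.2 - t * p.2) = dot2 u x - t * dot2 u p.
  by rewrite /dot2 /=; ring.
have [t1|t1] := ltP t 1.
  have t1' : 0 < 1 - t by rewrite subr_gt0.
  exists t; split; first by rewrite t0 ltW.
  exists ((x.1 - t * p.1) / (1 - t), (x.2 - t * p.2) / (1 - t)).
    move=> u uU; have := ht _ uU; rewrite -dz /dot2 /= => h.
    rewrite -(ler_pM2l t1').
    rewrite (_ : _ * (_ + _) = u.1 * (x.1 - t * p.1) + u.2 * (x.2 - t * p.2)); last first.
      by field; rewrite gt_eqF.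
    by rewrite mulr1.
  by case: x {h1 h2 h1' h2' ht dz} => x1 x2; rewrite /mix /=; congr pair; field; rewrite gt_eqF.
(* Here [t >= 1], so no constraint is positive at this difference. *)
have z0 : (x.1 - t * p.1, x.2 - t * p.2) = (0, 0).
  by apply: (sqbounded_ray bU) => u uU; rewrite dz; have := ht _ uU; lra.
have [u uU _] := sqbounded_right bU.
have te : t = 1.
  by have := ht _ uU; rewrite -dz z0 /dot2 !mulr0 addr0; lra.
case: z0; rewrite te !mul1r => e1 e2.
exists 1; split; first by rewrite ler01 lexx.
exists (0, 0); first exact: halfplanes0.
by rewrite /mix [LHS]surjective_pairing; congr pair => /=; lra.
Qed.

Lemma sqbounded_cone p U : sqbounded (HP U) -> sqbounded (HP (cone_constraints p U)).
Proof.
move=> bU; have [r hr] := bU; exists (r + `|p.1| + `|p.2|) => x.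
rewrite halfplanes_cone// => -[t [/andP[t0 t1] [y /hr [y1 y2] ->]]] /=.
have key (a b : R) : `|a| <= r -> `|(1 - t) * a + t * b| <= r + `|b|.
  move=> ar; apply: le_trans (ler_normD _ _) _; rewrite !normrM.
  apply: lerD.
    by apply: le_trans ar; rewrite ler_piMl// ger0_norm ?subr_ge0//; lra.
  by rewrite ler_piMl// ger0_norm.
have n1 := normr_ge0 p.1; have n2 := normr_ge0 p.2.
by split; [have := key _ p.1 y1|have := key _ p.2 y2]; lra.
Qed.

End MinkowskiWeyl.

(** * Passing between vertices and constraints *)

Section MinkowskiWeyl2.
Variable R : realType.
Notation pt := (R * R)%type.
Local Notation HP := (@halfplanes R).
Implicit Types (U V W : seq pt) (x y u v : pt).

Lemma conv_hull_convex n (v : 'I_n -> pt) t x y : 0 <= t <= 1 ->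
  conv_hull_fin v x -> conv_hull_fin v y -> conv_hull_fin v (mix t x y).
Proof.
move=> /andP[t0 t1] [l [l0 [l1 ->]]] [m [m0 [m1 ->]]].
exists (fun i => (1 - t) * l i + t * m i); split; last split.
- by move=> i; rewrite addr_ge0// mulr_ge0// subr_ge0.
- by rewrite big_split -!mulr_sumr l1 m1 /=; ring.
- by rewrite /mix /=; congr pair; rewrite !mulr_sumr -big_split; apply: eq_bigr => i _ /=; ring.
Qed.

Lemma conv_hull_vertex n (v : 'I_n -> pt) i : conv_hull_fin v (v i).
Proof.
have sumd (f : 'I_n -> R) : \sum_(j < n) (j == i)%:R * f j = f i.
  rewrite (bigD1 i)//= eqxx mul1r big1 ?addr0// => j /negbTE ->.
  by rewrite mul0r.
exists (fun j => (j == i)%:R); split=> [j|]; first by case: eqP.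
split; last by rewrite !sumd -surjective_pairing.
by rewrite (bigD1 i)//= eqxx big1 ?addr0// => j /negbTE ->.
Qed.

Lemma halfplanes_join n (v : 'I_n -> pt) U : sqbounded (HP U) ->
  exists2 W, sqbounded (HP W) & forall x, HP W x <->
    exists t l y, [/\ 0 <= t, forall i, 0 <= l i, t + \sum_(i < n) l i = 1, HP U y &
      x = (t * y.1 + \sum_(i < n) l i * (v i).1, t * y.2 + \sum_(i < n) l i * (v i).2)].
Proof.
move=> bU; elim: n v => [|n IH] v.
  exists U => // x; split=> [xU|[t [l [y [_ _ + yU ->]]]]].
    exists 1, (fun _ => 0), x; rewrite !big_ord0 addr0 !mul1r !addr0; split=> //.
    by rewrite -surjective_pairing.
  by rewrite !big_ord0 !addr0 => ->; rewrite !mul1r -surjective_pairing.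
have [W bW hW] := IH (fun i => v (lift ord0 i)).
exists (cone_constraints (v ord0) W); first exact: sqbounded_cone.
move=> x; rewrite halfplanes_cone//; split.
  move=> [s [/andP[s0 s1] [z /hW [t [l [y [t0 l0 tl1 yU ->]]]] ->]]].
  exists ((1 - s) * t), (fun i => if unlift ord0 i is Some j then (1 - s) * l j else s), y.
  rewrite !big_ord_recl !unlift_none; split=> //.
  - by rewrite mulr_ge0// subr_ge0.
  - by move=> i; case: unliftP => // j _; rewrite mulr_ge0// subr_ge0.
  - under eq_bigr do rewrite liftK.
    rewrite -mulr_sumr; have -> : (1 - s) * t + (s + (1 - s) * \sum_(i < n) l i) =
      (1 - s) * (t + \sum_(i < n) l i) + s by ring.
    by rewrite tl1; ring.
  - rewrite /mix /=; congr pair.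
      under [in RHS]eq_bigr do rewrite liftK -mulrA.
      by rewrite -mulr_sumr; ring.
    under [in RHS]eq_bigr do rewrite liftK -mulrA.
    by rewrite -mulr_sumr; ring.
move=> [t [l [y [t0 l0 tl1 yU ->]]]].
have S0 : 0 <= \sum_(i < n) l (lift ord0 i) by apply: sumr_ge0.
move: tl1; rewrite !big_ord_recl => tl1.
have [s1|s1] := ltP (l ord0) 1; last first.
  exists 1; split; first by rewrite ler01 lexx.
  exists (0, 0); first exact: halfplanes0.
  have l1 : l ord0 = 1 by lra.
  have t00 : t = 0 by lra.
  have li0 i : l (lift ord0 i) = 0.
    have /psumr_eq0P : \sum_(i < n) l (lift ord0 i) = 0 by lra.
    by apply.
  rewrite l1 t00 !mul0r /mix /= !big1 => [|i _|i _]; try by rewrite li0 mul0r.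
  by congr pair; ring.
have s1' : 0 < 1 - l ord0 by rewrite subr_gt0.
exists (l ord0); split; first by rewrite l0 ltW.
exists ((t * y.1 + \sum_(i < n) l (lift ord0 i) * (v (lift ord0 i)).1) / (1 - l ord0),
        (t * y.2 + \sum_(i < n) l (lift ord0 i) * (v (lift ord0 i)).2) / (1 - l ord0)).
  apply/hW; exists (t / (1 - l ord0)), (fun i => l (lift ord0 i) / (1 - l ord0)), y; split=> //.
  - by rewrite divr_ge0// ltW.
  - by move=> i; rewrite divr_ge0// ltW.
  - rewrite -mulr_suml -mulrDl; apply: (mulIf (lt0r_neq0 s1')); rewrite divfK ?gt_eqF// mul1r; lra.
  - have e (f : 'I_n -> R) : \sum_(i < n) l (lift ord0 i) / (1 - l ord0) * f i =
        (\sum_(i < n) l (lift ord0 i) * f i) / (1 - l ord0).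
      by rewrite mulr_suml; apply: eq_bigr => i _; ring.
    by rewrite !e; congr pair; field; rewrite gt_eqF.
rewrite /mix /=; congr pair; field; by rewrite gt_eqF.
Qed.

(** Joining the vertices to a bounded polygon inside their hull gives back the hull. *)
Lemma conv_hull_halfplanes n (v : 'I_n -> pt) U : sqbounded (HP U) ->
  HP U `<=` conv_hull_fin v -> exists2 W, sqbounded (HP W) & conv_hull_fin v = HP W.
Proof.
move=> bU Uv; have [W bW hW] := halfplanes_join v bU; exists W => //.
apply/seteqP; split=> x.
  move=> [l [l0 [l1 ->]]]; apply/hW; exists 0, l, (0, 0); split=> //.
  - by rewrite add0r.
  - exact: halfplanes0.
  - by rewrite !mul0r !add0r.
move=> /hW [t [l [y [t0 l0 tl1 /Uv [m [m0 [m1 ->]]] ->]]]].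
exists (fun i => t * m i + l i); split; last split.
- by move=> i; rewrite addr_ge0// mulr_ge0.
- by rewrite big_split -mulr_sumr m1 mulr1.
- by congr pair => /=; rewrite mulr_sumr -big_split; apply: eq_bigr => i _ /=; ring.
Qed.

Definition hull V := conv_hull_fin (fun i : 'I_(size V) => nth (0, 0) V i).

Lemma hull_mem V v : v \in V -> hull V v.
Proof.
move=> vV; have iV : (index v V < size V)%N by rewrite index_mem.
by have := conv_hull_vertex (fun i => nth (0, 0) V (nat_of_ord i)) (Ordinal iV); rewrite /= nth_index.
Qed.

Lemma hull_dot2 V x u : (forall v, v \in V -> dot2 v u <= 1) -> hull V x -> dot2 x u <= 1.
Proof.
move=> h [l [l0 [l1 ->]]]; rewrite /dot2 /= !mulr_suml -big_split /=.
rewrite -l1; apply: ler_sum => i _.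
have := h _ (mem_nth (0, 0) (ltn_ord i)) => hi.
have : l i * dot2 (nth (0, 0) V i) u <= l i * 1 by rewrite ler_wpM2l.
by rewrite /dot2; lra.
Qed.

Local Notation sq e := (quad e e e 0 e 0).

Lemma sqP (e : R) x : 0 < e -> HP (sq e) x <-> (`|x.1| <= e^-1 /\ `|x.2| <= e^-1).
Proof.
move=> e0; case: x => X Y; rewrite !halfplanes_cons /dot2 /= !ler_norml.
have h a : (e * a <= 1) = (a <= e^-1) by rewrite -[in RHS](ler_pM2l e0) mulfV ?gt_eqF.
have hN a : (- e * a <= 1) = (- e^-1 <= a) by rewrite mulNr -mulrN h lerNl.
rewrite !mul0r !add0r !addr0 !h !hN; split; first by move=> [-> [-> [-> [-> _]]]].
by move=> [/andP[-> ->] /andP[-> ->]]; do !split; exact: halfplanes_nil.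
Qed.

Lemma sq_hull (e : R) V : 0 < e -> {subset sq e <= V} -> HP (sq (2 / e)) `<=` hull V.
Proof.
move=> e0 sV -[X Y]; rewrite sqP ?divr_gt0// => -[/=]; rewrite !ler_norml invf_div => /andP[X1 X2] /andP[Y1 Y2].
have seg (a : pt) z : hull V a -> hull V (- a.1, - a.2) -> - (1 / 2) <= z -> z <= 1 / 2 ->
    hull V (2 * z * a.1, 2 * z * a.2).
  move=> h1 h2 z1 z2.
  have := conv_hull_convex (t := (1 / 2 - z)) _ h1 h2.
  have -> : mix (1 / 2 - z) a (- a.1, - a.2) = (2 * z * a.1, 2 * z * a.2).
    by rewrite /mix /=; congr pair; field.
  by apply; apply/andP; split; lra.
have mV u : u \in sq e -> hull V u by move=> /sV; exact: hull_mem.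
have b z : - (e / 2) <= z -> z <= e / 2 -> - (1 / 2) <= z / e /\ z / e <= 1 / 2.
  move=> z1 z2; split; first by rewrite ler_pdivlMr//; lra.
  by rewrite ler_pdivrMr//; lra.
have [X1' X2'] := b _ X1 X2; have [Y1' Y2'] := b _ Y1 Y2.
have hX := seg (e, 0) (X / e) ltac:(apply: mV; rewrite !inE eqxx !orbT//)
  ltac:(apply: mV; rewrite /= oppr0 !inE eqxx !orbT//) X1' X2'.
have hY := seg (0, e) (Y / e) ltac:(apply: mV; rewrite !inE eqxx//)
  ltac:(apply: mV; rewrite /= oppr0 !inE eqxx !orbT//) Y1' Y2'.
have := conv_hull_convex (t := 1 / 2) _ hX hY.
have -> : mix (1 / 2) (2 * (X / e) * e, 2 * (X / e) * 0) (2 * (Y / e) * 0, 2 * (Y / e) * e) = (X, Y).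
  by rewrite /mix /=; congr pair; field; rewrite gt_eqF.
by apply; apply/andP; split; lra.
Qed.

Lemma hull_halfplanes (e : R) V : 0 < e -> {subset sq e <= V} ->
  exists2 W, sqbounded (HP W) & hull V = HP W.
Proof.
move=> e0 sV; apply: (conv_hull_halfplanes _ (sq_hull e0 sV)).
by apply: bquad; rewrite divr_gt0.
Qed.

Lemma halfplanes_nbhs U : exists2 e, 0 < e & HP (sq e) `<=` HP U.
Proof.
elim: U => [|u U [e e0 IH]]; first by exists 1 => // x _; exact: halfplanes_nil.
exists (e + (`|u.1| + `|u.2|)); first by rewrite ltr_pwDl// addr_ge0.
set f := e + _; have f0 : 0 < f by rewrite ltr_pwDl// addr_ge0.
have n1 := normr_ge0 u.1; have n2 := normr_ge0 u.2.
have ef : f^-1 <= e^-1 by rewrite lef_pV2//; rewrite /f; lra.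
move=> x /(sqP _ f0) [x1 x2]; apply/halfplanes_cons; split.
  have h1 : u.1 * x.1 <= `|u.1| * f^-1.
    by apply: le_trans (ler_norm _) _; rewrite normrM ler_wpM2l.
  have h2 : u.2 * x.2 <= `|u.2| * f^-1.
    by apply: le_trans (ler_norm _) _; rewrite normrM ler_wpM2l.
  rewrite /dot2; apply: le_trans (lerD h1 h2) _.
  by rewrite -mulrDl ler_pdivrMr// mul1r /f; lra.
by apply: IH; apply/(sqP _ e0); split; [exact: le_trans x1 ef|exact: le_trans x2 ef].
Qed.

(** The hull of [U] is written with constraints [W], and by bipolarity [W] spans the polygon. The
    added squares make [hull_halfplanes] applicable and are harmless: one consists of implied
    constraints, the other of points of the polygon. *)
Lemma halfplanes_polygon U : sqbounded (HP U) -> convex_polygon (HP U).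
Proof.
move=> [r hr].
have [e e0 eU] := halfplanes_nbhs U.
have r1 : 0 < `|r| + 1 by rewrite ltr_wpDl.
set f := (`|r| + 1)^-1; have f0 : 0 < f by rewrite invr_gt0.
have [W _ eW] := @hull_halfplanes f (sq f ++ U) f0 (mem_subseq (prefix_subseq _ _)).
have e0' : 0 < e^-1 by rewrite invr_gt0.
have [S _ eS] := @hull_halfplanes e^-1 (sq e^-1 ++ W) e0' (mem_subseq (prefix_subseq _ _)).
exists (size (sq e^-1 ++ W)), (fun i => nth (0, 0) (sq e^-1 ++ W) i).
rewrite -/(hull _); apply/seteqP; split => x; last first.
  move=> xh u uU; have -> : dot2 u x = dot2 x u by rewrite /dot2; ring.
  apply: hull_dot2 xh => v; rewrite mem_cat => /orP[vs|vW].
    have -> : dot2 v u = dot2 u v by rewrite /dot2; ring.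
    apply: eU (uU); apply/(sqP _ e0).
    by move: vs; rewrite !inE => /or4P[]/eqP-> /=; rewrite ?normrN ?normr0 ger0_norm ?(ltW e0') ?lexx// ltW.
  have : hull (sq f ++ U) u by apply: hull_mem; rewrite mem_cat uU orbT.
  by rewrite eW => /(_ _ vW).
move=> xU; rewrite eS => s sS.
have : hull (sq f ++ U) s.
  rewrite eW => w wW; have -> : dot2 w s = dot2 s w by rewrite /dot2; ring.
  have : hull (sq e^-1 ++ W) w by apply: hull_mem; rewrite mem_cat wW orbT.
  by rewrite eS => /(_ _ sS).
apply: hull_dot2 => v; rewrite mem_cat => /orP[|vU]; last exact: xU.
have [x1 x2] := hr _ xU.
have xf : HP (sq f) x.
  apply/(sqP _ f0); rewrite invrK; have := ler_norm r; split; lra.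
exact: xf.
Qed.

Lemma halfplanes_Po U : sqbounded (HP U) -> Po (HP U).
Proof.
move=> bU; split; first exact: halfplanes_polygon.
have [e e0 eU] := halfplanes_nbhs U.
have e0' : 0 < e^-1 by rewrite invr_gt0.
apply/nbhs_ballP; exists e^-1 => //= -[X Y] [/=].
rewrite /ball /= !sub0r !normrN => X1 Y1.
by apply: eU; apply/(sqP _ e0); split; exact: ltW.
Qed.

Lemma Po_halfplanes P : Po P -> exists2 U, sqbounded (HP U) & P = HP U.
Proof.
move=> [[n [v ->]] /nbhs_ballP [e /= e0 he]].
have e0' : 0 < 2 / e by rewrite divr_gt0.
apply: (@conv_hull_halfplanes _ _ (sq (2 / e))); first exact: bquad.
move=> [X Y] /(sqP _ e0') [/=]; rewrite invf_div => X1 Y1; apply: he.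
by split; rewrite /= /ball /= sub0r normrN; lra.
Qed.

End MinkowskiWeyl2.

(** * Polar bodies *)

Section Polar.
Variable R : realType.
Notation pt := (R * R)%type.
Local Notation HP := (@halfplanes R).
Implicit Types (U V W : seq pt) (x y u v : pt) (P Q : set pt).
Local Notation sq e := (quad e e e 0 e 0).

Lemma dot2C x y : dot2 x y = dot2 y x.
Proof. by rewrite /dot2 /=; ring. Qed.

Lemma polar_sq e P y : 0 < e -> HP (sq e) `<=` P -> polar P y -> `|y.1| <= e /\ `|y.2| <= e.
Proof.
move=> e0 eP yP; have e0' : 0 < e^-1 by rewrite invr_gt0.
have h (a b : R) : `|a| <= e^-1 -> `|b| <= e^-1 -> y.1 * a + y.2 * b <= 1.
  by move=> ha hb; apply: (yP (a, b)); apply: eP; exact/sqP.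
have n1 : `|e^-1| <= e^-1 by rewrite ger0_norm// ltW.
have n0 : `|0 : R| <= e^-1 by rewrite normr0 ltW.
have n1' : `|- e^-1| <= e^-1 by rewrite normrN.
have := h _ _ n1 n0; have := h _ _ n1' n0; have := h _ _ n0 n1; have := h _ _ n0 n1'.
rewrite !mulr0 !add0r !addr0 !mulrN -!mulNr !ler_pdivrMr// !mul1r => h1 h2 h3 h4.
by rewrite !ler_norml; split; apply/andP; split; lra.
Qed.

Lemma polar_halfplanes U : sqbounded (HP U) ->
  exists2 V, sqbounded (HP V) & polar (HP U) = HP V.
Proof.
move=> bU; have [n [v ev]] := halfplanes_polygon bU.
have eV : polar (HP U) = HP [seq v i | i <- enum 'I_n].
  apply/seteqP; split=> y yP.
    move=> _ /mapP[i _ ->]; rewrite dot2C; apply: yP; rewrite ev.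
    exact: conv_hull_vertex.
  move=> x; rewrite ev => -[l [l0 [l1 ->]]].
  rewrite dot2C /dot2 /= !mulr_suml -big_split /= -l1; apply: ler_sum => i _.
  have : l i * dot2 (v i) y <= l i * 1.
    by rewrite ler_wpM2l//; apply: yP; apply: map_f; rewrite mem_enum.
  by rewrite /dot2; lra.
exists [seq v i | i <- enum 'I_n] => //; rewrite -eV.
have [e e0 he] := halfplanes_nbhs U.
by exists e => y; exact: polar_sq.
Qed.

Lemma polarU P Q : polar (P `|` Q) = polar P `&` polar Q.
Proof.
apply/seteqP; split=> y /=.
  by move=> h; split=> x xP; apply: h; [left|right].
by move=> [h1 h2] x [/h1|/h2].
Qed.

(* If [y] were in neither polar, a segment from [P] to [Q] on which [dot2 y] exceeds [1] would have to cross [P `&` Q]. *)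
Lemma polarI U V W : HP U `|` HP V = HP W ->
  polar (HP U `&` HP V) = polar (HP U) `|` polar (HP V).
Proof.
move=> UVW; apply/seteqP; split=> y; last by move=> [h|h] x [xU xV]; exact: h.
move=> yUV; apply: contrapT => /not_orP[].
move=> /existsNP[a /not_implyP[aU /negP]]; rewrite -ltNge => ya.
move=> /existsNP[b /not_implyP[bV /negP]]; rewrite -ltNge => yb.
(* [sup T] is the last parameter at which the segment is in [HP U]; points just after it must be in
   [HP V]. *)
pose T := [set t : R | 0 <= t <= 1 /\ HP U (mix t a b)].
have mix0 : mix 0 a b = a by rewrite /mix; case: a {aU ya T} => ? ? /=; congr pair; ring.
have mix1 : mix 1 a b = b by rewrite /mix; case: b {bV yb T mix0} => ? ? /=; congr pair; ring.
have T0 : T 0 by split; rewrite ?lexx ?ler01// mix0.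
have ubT : ubound T 1 by move=> t [/andP[]].
have sT t : T t -> t <= sup T by apply: ub_le_sup; exists 1.
have s0 : 0 <= sup T := sT _ T0.
have s1 : sup T <= 1 by apply: ge_sup => //; exists 0.
have s01 : 0 <= sup T <= 1 by rewrite s0.
have aff u t : dot2 u (mix t a b) = dot2 u a + t * (dot2 u b - dot2 u a).
  by rewrite dot2_mix; ring.
have sU : HP U (mix (sup T) a b).
  move=> u uU; rewrite aff; have [g0|g0] := leP (dot2 u b - dot2 u a) 0.
    have : sup T * (dot2 u b - dot2 u a) <= 0 by rewrite mulr_ge0_le0.
    by have := aU _ uU; lra.
  rewrite -lerBrDl -ler_pdivlMr//; apply: ge_sup; first by exists 0.
  by move=> t [_ /(_ _ uU)]; rewrite aff ler_pdivlMr// lerBrDl.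
have sV : HP V (mix (sup T) a b).
  move: s1; rewrite le_eqVlt => /orP[/eqP ->|s1]; first by rewrite mix1.
  have tV t : sup T < t -> t <= 1 -> HP V (mix t a b).
    move=> st t1; have t01 : 0 <= t <= 1 by rewrite t1 (le_trans s0 (ltW st)).
    have : HP W (mix t a b).
      by apply: halfplanes_convex; rewrite // -UVW; [left|right].
    rewrite -UVW => -[tU|//].
    by have := sT t (conj t01 tU); rewrite leNgt st.
  move=> u uV; rewrite leNgt; apply/negP => g1.
  have := tV _ s1 (lexx _) _ uV; have := g1; rewrite !aff mul1r => k1 k2.
  set k := dot2 u b - dot2 u a in k1 k2 *.
  have k0 : k < 0.
    rewrite ltNge; apply/negP => k0.
    have : sup T * k <= 1 * k by rewrite ler_wpM2r// ltW.
    lra.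
  (* The excess of [u] over 1 falls at rate [- k]; a step that uses at most half of it stays outside
     [HP V]. *)
  pose t := sup T + Num.min (1 - sup T) ((dot2 u a + sup T * k - 1) / - k / 2).
  have d0 : 0 < (dot2 u a + sup T * k - 1) / - k / 2.
    by rewrite !divr_gt0// ?oppr_gt0// subr_gt0.
  have t1 : t <= 1 by rewrite /t -lerBrDl ge_min lexx.
  have t2 : sup T < t by rewrite /t ltrDl lt_min d0 subr_gt0 s1.
  have := tV t t2 t1 _ uV; rewrite aff -/k.
  have : t * k >= sup T * k - (dot2 u a + sup T * k - 1) / 2.
    have : Num.min (1 - sup T) ((dot2 u a + sup T * k - 1) / - k / 2) <=
        (dot2 u a + sup T * k - 1) / - k / 2 by rewrite ge_min lexx orbT.
    set m := Num.min _ _; rewrite /t -/m => hm.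
    have : ((dot2 u a + sup T * k - 1) / - k / 2) * k <= m * k by rewrite ler_wnM2r// ltW.
    have -> : (dot2 u a + sup T * k - 1) / - k / 2 * k = - ((dot2 u a + sup T * k - 1) / 2).
      by field; rewrite lt_eqF.
    lra.
  lra.
have := yUV _ (conj sU sV); rewrite dot2_mix.
have : (1 - sup T) * 1 <= (1 - sup T) * dot2 y a by rewrite ler_wpM2l ?subr_ge0// ltW.
have [/eqP s1'|s1'] := boolP (sup T == 1).
  by rewrite s1' subrr !mul0r add0r mul1r; lra.
have s1'' : 0 < 1 - sup T by rewrite subr_gt0 lt_neqAle s1'.
have : (1 - sup T) * 1 < (1 - sup T) * dot2 y a by rewrite ltr_pM2l.
have : sup T * 1 <= sup T * dot2 y b by rewrite ler_wpM2l// ltW.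
lra.
Qed.

Lemma dot2_lin a b c d x y : dot2 (lin a b c d x) y = dot2 x (lin a c b d y).
Proof. by rewrite /dot2 /lin /=; ring. Qed.

Lemma polar_shear t U :
  polar (HP (map (lin 1 0 t 1) U)) = lin 1 0 (- t) 1 @^-1` polar (HP U).
Proof.
apply/seteqP; split=> y /= h x.
  move=> xU; rewrite dot2_lin; apply: h; apply/halfplanes_lin; rewrite lin_comp.
  by rewrite (_ : lin _ _ _ _ x = x)//; case: x {xU} => ? ?; rewrite /lin /=; congr pair; ring.
move=> /halfplanes_lin /h; rewrite dot2_lin lin_comp.
by rewrite (_ : lin _ _ _ _ x = x)//; case: x => ? ?; rewrite /lin /=; congr pair; ring.
Qed.

Lemma polar_swap U : polar (HP (map (lin 0 1 1 0) U)) = lin 0 1 1 0 @^-1` polar (HP U).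
Proof.
apply/seteqP; split=> y /= h x.
  move=> xU; rewrite dot2_lin; apply: h; apply/halfplanes_lin; rewrite lin_comp.
  by rewrite (_ : lin _ _ _ _ x = x)//; case: x {xU} => ? ?; rewrite /lin /=; congr pair; ring.
move=> /halfplanes_lin /h; rewrite dot2_lin lin_comp.
by rewrite (_ : lin _ _ _ _ x = x)//; case: x => ? ?; rewrite /lin /=; congr pair; ring.
Qed.

End Polar.

(** * Measurable solutions of the Cauchy equation *)

Section CauchyEquation.
Variable R : realType.

Lemma lebesgue_measure_translate (a : R) (A : set R) : measurable A ->
  lebesgue_measure ((fun x => x + a) @^-1` A) = lebesgue_measure A.
Proof.
move=> mA; have mf : measurable_fun [set: measurableTypeR R] (fun x : R => x + a : measurableTypeR R).
  exact: measurable_funD.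
rewrite -[LHS]/(pushforward lebesgue_measure (fun x : R => x + a : measurableTypeR R) A).
apply/esym/lebesgue_measure_unique => // _ [[b c]] _ <-.
rewrite -[RHS]/(lebesgue_measure ((fun x : R => x + a) @^-1` `]b, c])).
have -> : (fun x : R => x + a) @^-1` `]b, c] = `]b - a, c - a]%classic.
  apply/seteqP; split => x /=; rewrite !in_itv /= => /andP[? ?]; apply/andP; split; lra.
by rewrite !lebesgue_measure_itv /= !lte_fin ltrD2r; case: ifPn => // _; rewrite -!EFinB; congr (_%:E); lra.
Qed.

(** If [E] and its translate were disjoint, a measure above 3/2 would fit into an interval of length
    3/2. *)
Lemma Steinhaus (E : set R) (h : R) : measurable E -> E `<=` `]0, 1[ ->
  ((3 / 4)%:E < lebesgue_measure E)%E -> 0 <= h < 1 / 2 -> exists2 x, E x & E (x + h).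
Proof.
move=> mE E01 mu34 /andP[h0 h1]; apply: contrapT => no.
set F := (fun x => x + h) @^-1` E.
have mF : measurable F.
  rewrite -[F]setTI; have mf : measurable_fun [set: R] (fun x : R => x + h) by exact: measurable_funD.
  exact: mf.
have EF0 : E `&` F = set0.
  by apply/seteqP; split => // x [Ex Fx]; apply: no; exists x.
have sub : E `|` F `<=` `]- (1 / 2), 1[%classic.
  move=> x [/E01|/E01] /=; rewrite !in_itv /= => /andP[? ?]; apply/andP; split; lra.
have eF : lebesgue_measure F = lebesgue_measure E := lebesgue_measure_translate h mE.
have e : lebesgue_measure (E `|` F) = (lebesgue_measure E + lebesgue_measure E)%E.
  by rewrite -{2}eF; exact: measureU.
have : (lebesgue_measure (E `|` F) <= lebesgue_measure (`]- (1 / 2), 1[%classic%R : set R))%E.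
  by apply: le_measure => //; rewrite inE//; exact: measurableU.
rewrite e lebesgue_measure_itv /= lte_fin ifT; last lra.
rewrite leNgt => /negP; apply.
apply: (@le_lt_trans _ _ ((3 / 4)%:E + (3 / 4)%:E)%E); last exact: lteD.
by rewrite -EFinD lee_fin; lra.
Qed.

(** Subtracting [f 1 * t] gives an additive function that vanishes at 1. Writing [t] as an integer
    plus [2 * s] with [s] in [0, 1/2) bounds it for all [t >= 0], and [g (n t) = n g t] then forces
    it to be 0. *)
Lemma additive_bounded_linear (f : R -> R) (M : R) : {morph f : x y / x + y} ->
  (forall h, 0 <= h < 1 / 2 -> `|f h| <= M) -> forall t, f t = f 1 * t.
Proof.
move=> fD fM.
have M0 : 0 <= M by apply: le_trans (fM 0 _); rewrite // lexx; lra.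
set g := fun t => f t - f 1 * t.
have gD : {morph g : x y / x + y} by move=> x y; rewrite /g fD; ring.
have g1 : g 1 = 0 by rewrite /g mulr1 subrr.
have g0 : g 0 = 0 by have := gD 0 0; rewrite addr0; lra.
have gn n t : g (n%:R * t) = n%:R * g t.
  elim: n => [|n IH]; first by rewrite !mul0r.
  by rewrite -natr1 mulrDl mul1r gD IH; ring.
set K := 2 * (M + `|f 1|).
have gK t : 0 <= t -> `|g t| <= K.
  move=> t0; have /andP[n1 n2] := truncn_itv t0.
  set s := (t - (Num.truncn t)%:R) / 2.
  have s0 : 0 <= s < 1 / 2 by move: n2; rewrite -natr1 /s => n2; apply/andP; split; lra.
  have -> : g t = 2 * g s.
    have := gn 2%N s; have := gn (Num.truncn t) 1; rewrite g1 mulr1 mulr0 => e1 e2.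
    have : g t = g (2%:R * s) + g (Num.truncn t)%:R by rewrite -gD; congr g; rewrite /s; field.
    by rewrite e1 e2 addr0.
  rewrite normrM ger0_norm// ler_pM2l// /g.
  apply: le_trans (ler_normB _ _) _; apply: lerD; first exact: fM.
  rewrite normrM ler_piMr//; case/andP: s0 => s0 s1.
  by rewrite ger0_norm//; lra.
have gpos t : 0 <= t -> g t = 0.
  move=> t0; apply/eqP/negPn/negP => gt0.
  have gt0' : 0 < `|g t| by rewrite normr_gt0.
  have K0 : 0 <= K / `|g t| by rewrite divr_ge0// (le_trans _ (gK 0 (lexx _))).
  have /andP[_] := truncn_itv K0.
  set n := (Num.truncn _).+1 => n2.
  have := gK (n%:R * t) (mulr_ge0 (ler0n _ _) t0).
  rewrite gn normrM ger0_norm// leNgt.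
  by rewrite ltr_pdivrMr// in n2; rewrite n2.
move=> t; apply/eqP; rewrite -subr_eq0 -/(g t); apply/eqP.
have [t0|/ltW t0] := leP 0 t; first exact: gpos.
have := gD t (- t); rewrite subrr g0 (gpos (- t)) ?oppr_ge0//; lra.
Qed.

End CauchyEquation.

(** * Moments of polar bodies *)

Section Moment.
Variable R : realType.
Notation pt := (R * R)%type.
Local Notation HP := (@halfplanes R).
Local Notation mR := (measurableTypeR R).
Implicit Types (U V W : seq pt).
Local Notation sq e := (quad e e e 0 e 0).
Local Notation mu2 := (@leb2 R).

Lemma measurable_coord1 : measurable_fun [set: mR * mR] (fst : mR * mR -> R).
Proof. exact: measurable_fst. Qed.
Lemma measurable_coord2 : measurable_fun [set: mR * mR] (snd : mR * mR -> R).
Proof. exact: measurable_snd. Qed.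

Lemma measurable_dot2 (u : pt) : measurable_fun [set: mR * mR] (fun x : mR * mR => dot2 u x : R).
Proof.
apply: measurable_funD; apply: measurable_funM; try exact: measurable_cst.
  exact: measurable_coord1.
exact: measurable_coord2.
Qed.

Lemma measurable_halfplanes U : measurable (HP U : set (mR * mR)).
Proof.
elim: U => [|u U IH].
  by rewrite (_ : HP _ = setT)//; apply/seteqP; split=> // x _; exact: halfplanes_nil.
rewrite (_ : HP _ = [set x | dot2 u x <= 1] `&` HP U); last first.
  by apply/seteqP; split=> x /halfplanes_cons.
apply: measurableI => //.
rewrite (_ : [set _ | _] = setT `&` (fun x : mR * mR => dot2 u x : R) @^-1` `]-oo, 1]%classic).
  exact: measurable_dot2.
by rewrite setTI; apply/seteqP; split=> x /=; rewrite in_itv.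
Qed.

Lemma mu2_sqbounded (S : set pt) : measurable (S : set (mR * mR)) -> sqbounded S -> (mu2 S < +oo)%E.
Proof.
move=> mS [r hr].
apply: (@le_lt_trans _ _ (mu2 ((`[- r, r]%classic : set mR) `*` (`[- r, r]%classic : set mR)))).
  apply: le_measure; rewrite ?inE//; first exact: measurableX.
  by move=> x /hr [h1 h2]; split; rewrite /= in_itv /= -ler_norml.
have [s hs] : exists s : R, lebesgue_measure (`[- r, r]%classic : set R) = s%:E.
  rewrite lebesgue_measure_itv /=; case: ifP => _; last by exists 0.
  by exists (r - - r); rewrite EFinB.
rewrite (_ : mu2 _ = (s * s)%:E) ?ltry// EFinM -!hs.
by apply: product_measure1E; exact: measurable_itv.
Qed.

Lemma integrable_bounded (S : set pt) (f : pt -> R) (M : R) : measurable (S : set (mR * mR)) ->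
  sqbounded S -> measurable_fun [set: mR * mR] (f : mR * mR -> R) ->
  (forall x, S x -> `|f x| <= M) -> mu2.-integrable S (EFin \o f).
Proof.
move=> mS bS mf fM; apply: measurable_bounded_integrable => //.
- exact: mu2_sqbounded.
- exact: measurable_funTS.
- exists M; split; first exact: num_real.
  by move=> x Mx y Sy; apply: le_trans (fM y Sy) (ltW Mx).
Qed.

Lemma integrable_coord (S : set pt) : measurable (S : set (mR * mR)) -> sqbounded S ->
  mu2.-integrable S (EFin \o fst) /\ mu2.-integrable S (EFin \o snd).
Proof.
move=> mS bS; have [r hr] := bS; split; [apply: (@integrable_bounded S (fun x => x.1) r)|apply: (@integrable_bounded S (fun x => x.2) r)] => //.
- exact: measurable_coord1.
- by move=> x /hr[].
- exact: measurable_coord2.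
- by move=> x /hr[].
Qed.

Lemma moment_setU (A B : set pt) : measurable (A : set (mR * mR)) -> measurable (B : set (mR * mR)) ->
  sqbounded A -> sqbounded B ->
  add2 (moment (A `|` B)) (moment (A `&` B)) = add2 (moment A) (moment B).
Proof.
move=> mA mB bA bB.
have mAB : measurable (A `&` B : set (mR * mR)) by exact: measurableI.
have mBA : measurable (B `\` A : set (mR * mR)) by exact: measurableD.
have bAB : sqbounded (A `|` B).
  have [r hr] := bA; have [s hs] := bB; exists (Num.max r s) => x [/hr|/hs] [h1 h2];
    by rewrite !le_max h1 h2 ?orbT.
have mAuB : measurable (A `|` B : set (mR * mR)) by exact: measurableU.
have key (f : pt -> R) : mu2.-integrable (A `|` B) (EFin \o f) ->
    Rintegral mu2 (A `|` B) f + Rintegral mu2 (A `&` B) f = Rintegral mu2 A f + Rintegral mu2 B f.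
  move=> intf.
  have intA : mu2.-integrable B (EFin \o f).
    by apply: (integrableS mAuB) => //; exact: subsetUr.
  have eU : A `|` B = A `|` B `\` A.
    apply/seteqP; split=> x [xA|xB]; try by left.
      by have [xA|xA] := pselect (A x); [left|right].
    by case: xB => xB _; right.
  have eB : B = A `&` B `|` B `\` A by rewrite setIC setUIDK.
  rewrite [in X in X + _ = _]eU [in X in _ = _ + X]eB !Rintegral_setU// -?eU -?eB//.
  - by ring.
  - by apply/disj_set2P; apply/seteqP; split=> // x [[xA _] [_ /(_ xA)]].
  - by apply/disj_set2P; apply/seteqP; split=> // x [xA [_ /(_ xA)]].
have [i1 i2] := integrable_coord mAuB bAB.
by rewrite /add2 /moment /= !key.
Qed.

(** A product measure is determined by its values on rectangles, so the push-forward under [phi] is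
    the measure itself. *)
Lemma Rintegral_preserving (phi : pt -> pt) (S : set pt) (f : pt -> R) :
  measurable_fun [set: mR * mR] (phi : mR * mR -> mR * mR) ->
  (forall A B : set mR, measurable A -> measurable B ->
    mu2 (phi @^-1` (A `*` B)) = (lebesgue_measure A * lebesgue_measure B)%E) ->
  measurable (S : set (mR * mR)) -> measurable_fun [set: mR * mR] (f : mR * mR -> R) ->
  mu2.-integrable (phi @^-1` S) (EFin \o (f \o phi)) ->
  Rintegral mu2 (phi @^-1` S) (f \o phi) = Rintegral mu2 S f.
Proof.
move=> mphi pres mS mf intf; rewrite /Rintegral; congr fine.
have mEf : measurable_fun [set: mR * mR] (EFin \o f) by exact/measurable_EFinP.
have := integral_pushforward mphi mEf intf mS.
rewrite /= => <-.
apply/esym; apply: eq_measure_integral => A mA _.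
apply: product_measure_unique mA => B C mB mC; exact: pres.
Qed.

Lemma lin_shearE t (x : pt) : lin 1 0 t 1 x = (x.1, t * x.1 + x.2).
Proof. by rewrite /lin; congr pair; ring. Qed.

Lemma measurable_lin_shear t : measurable_fun [set: mR * mR] (lin 1 0 t 1 : mR * mR -> mR * mR).
Proof.
rewrite (_ : lin 1 0 t 1 = fun x : mR * mR => (x.1, t * x.1 + x.2) : mR * mR); last first.
  by apply/funext => x; exact: lin_shearE.
apply: measurable_fun_pair; first exact: measurable_coord1.
apply: measurable_funD; last exact: measurable_coord2.
by apply: measurable_funM; [exact: measurable_cst|exact: measurable_coord1].
Qed.

Lemma measurable_lin_swap : measurable_fun [set: mR * mR] (lin 0 1 1 0 : mR * mR -> mR * mR).
Proof.
rewrite (_ : lin 0 1 1 0 = fun x : mR * mR => (x.2, x.1) : mR * mR); last first.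
  by apply/funext => x; rewrite /lin /=; congr pair; ring.
by apply: measurable_fun_pair; [exact: measurable_coord2|exact: measurable_coord1].
Qed.

(** Each vertical section of the preimage is a translate of [B]. *)
Lemma shear_preserving t (A B : set mR) : measurable A -> measurable B ->
  mu2 (lin 1 0 t 1 @^-1` (A `*` B)) = (lebesgue_measure A * lebesgue_measure B)%E.
Proof.
move=> mA mB; rewrite (_ : lin 1 0 t 1 = fun x : pt => (x.1, x.2 + t * x.1)); last first.
  by apply/funext => x; rewrite lin_shearE addrC.
rewrite /leb2 /product_measure1 /=.
rewrite (eq_integral (fun x => (\1_A x)%:E * lebesgue_measure B)%E); last first.
  move=> x _; rewrite indicE; have [xA|xA] /= := boolP (x \in A).
    rewrite mul1e -(lebesgue_measure_translate (t * x) mB); congr lebesgue_measure.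
    apply/seteqP; split=> y; rewrite /xsection /= inE /=; first by case.
    by split=> //; exact/set_mem.
  rewrite mul0e (_ : xsection _ _ = set0) ?measure0//.
  apply/seteqP; split=> // y; rewrite /xsection /= inE /= => -[/mem_set].
  by rewrite (negbTE xA).
rewrite ge0_integralZr//; first by rewrite integral_indic// setIT.
by apply: measurableT_comp => //; exact: measurable_indic.
Qed.

Lemma swap_preserving (A B : set mR) : measurable A -> measurable B ->
  mu2 (lin 0 1 1 0 @^-1` (A `*` B)) = (lebesgue_measure A * lebesgue_measure B)%E.
Proof.
move=> mA mB; rewrite (_ : _ @^-1` _ = B `*` A); last first.
  by apply/seteqP; split=> -[x y]; rewrite /lin /= !(mul0r, mul1r, add0r, addr0) => -[].
by rewrite /leb2 product_measure1E// muleC.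
Qed.

End Moment.

(** * The moment vector of the polar body as a covariant valuation *)

Section PolarMoment.
Variable R : realType.
Notation pt := (R * R)%type.
Local Notation HP := (@halfplanes R).
Local Notation mR := (measurableTypeR R).
Implicit Types (U V W : seq pt).
Local Notation sq e := (quad e e e 0 e 0).
Local Notation mu2 := (@leb2 R).

Definition polar_moment (P : set pt) : pt := moment (polar P).

Lemma polar_regular U : sqbounded (HP U) ->
  measurable (polar (HP U) : set (mR * mR)) /\ sqbounded (polar (HP U)).
Proof.
by move=> bU; have [V bV ->] := polar_halfplanes bU; split=> //; exact: measurable_halfplanes.
Qed.

Lemma polar_moment_valuation : hp_valuation polar_moment.
Proof.
move=> U V W bU bV bW UVW.
have [mU sU] := polar_regular bU; have [mV sV] := polar_regular bV.
rewrite /polar_moment -UVW halfplanes_cat polarU (polarI UVW) -(moment_setU mU mV sU sV).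
by rewrite /add2; congr pair; rewrite addrC.
Qed.

Lemma polar_moment_shear t : hp_covariant polar_moment 1 0 t 1.
Proof.
move=> U bU; have [mS bS] := polar_regular bU.
have bU' : sqbounded (HP (map (lin 1 0 t 1) U)).
  by apply: sqbounded_lin => //; rewrite mulr1 mul0r subr0 oner_eq0.
have [] := polar_regular bU'.
rewrite /polar_moment polar_shear; set S := polar (HP U) in mS bS * => mS' bS'.
have [i1 i2] := integrable_coord mS bS.
have [i1' i2'] := integrable_coord mS' bS'.
have pres := @shear_preserving R (- t).
have e1 : fst = (fst : pt -> R) \o lin 1 0 (- t) 1.
  by apply/funext => x /=; ring.
have e2 : snd = (fun z : pt => z.2 + t * z.1) \o lin 1 0 (- t) 1.
  by apply/funext => x /=; ring.
rewrite /moment {1}e1 {1}e2.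
rewrite (Rintegral_preserving (measurable_lin_shear (- t)) pres mS (@measurable_coord1 R)); last first.
  by rewrite -e1.
rewrite (Rintegral_preserving (f := fun z : pt => z.2 + t * z.1) (measurable_lin_shear (- t)) pres mS); last first.
- by rewrite -e2.
- apply: measurable_funD; first exact: measurable_coord2.
  by apply: measurable_funM; [exact: measurable_cst|exact: measurable_coord1].
rewrite RintegralD//; last first.
  by have := integrableZl mS t i1.
rewrite RintegralZl// /lin /=; congr pair; ring.
Qed.

Lemma polar_moment_swap : hp_covariant polar_moment 0 1 1 0.
Proof.
move=> U bU; have [mS bS] := polar_regular bU.
have bU' : sqbounded (HP (map (lin 0 1 1 0) U)).
  by apply: sqbounded_lin => //; rewrite mul0r mul1r sub0r oppr_eq0 oner_eq0.
have [] := polar_regular bU'.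
rewrite /polar_moment polar_swap; set S := polar (HP U) in mS bS * => mS' bS'.
have [i1' i2'] := integrable_coord mS' bS'.
have pres := @swap_preserving R.
have e1 : fst = (snd : pt -> R) \o lin 0 1 1 0.
  by apply/funext => x /=; ring.
have e2 : snd = (fst : pt -> R) \o lin 0 1 1 0.
  by apply/funext => x /=; ring.
have -> : moment (lin 0 1 1 0 @^-1` S) = (Rintegral mu2 (lin 0 1 1 0 @^-1` S) (snd \o lin 0 1 1 0),
    Rintegral mu2 (lin 0 1 1 0 @^-1` S) (fst \o lin 0 1 1 0)) by rewrite -e1 -e2.
rewrite (Rintegral_preserving (@measurable_lin_swap R) pres mS (@measurable_coord2 R)); last first.
  by rewrite -e1.
rewrite (Rintegral_preserving (@measurable_lin_swap R) pres mS (@measurable_coord1 R)); last first.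
  by rewrite -e2.
by rewrite /lin /=; congr pair; ring.
Qed.

(** The polar bodies all lie in one square. Thus subtracting the moment keeps a value bounded along
    the path. *)
Lemma polar_moment_bounded (e : R) : 0 < e ->
  exists M, forall U, sqbounded (HP U) -> HP (sq e) `<=` HP U -> `|(polar_moment (HP U)).2| <= M.
Proof.
move=> e0; have e0' : 0 < e^-1 by rewrite invr_gt0.
set B := HP (sq e^-1).
have mB : measurable (B : set (mR * mR)) by exact: measurable_halfplanes.
have bB : sqbounded B by exact: bquad.
exists (e * fine (mu2 B)) => U bU eU; have [mS bS] := polar_regular bU.
rewrite /polar_moment /moment /=; set S := polar _ in mS bS *.
have SB : S `<=` B by move=> y yS; apply/(sqP _ e0'); rewrite invrK; exact: (polar_sq e0 eU yS).
have [_ i2] := integrable_coord mS bS.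
apply: le_trans (le_normr_Rintegral mS i2) _.
apply: (@le_trans _ _ (Rintegral mu2 S (fun=> e))).
  apply: le_Rintegral => //.
  - apply: (@integrable_bounded _ _ _ e) => //.
      by apply: measurableT_comp => //; exact: measurable_coord2.
    by move=> x xS; rewrite normr_id; have [] := polar_sq e0 eU xS.
  - apply: (@integrable_bounded _ _ _ e) => // x _; by rewrite ger0_norm// ltW.
  - by move=> x xS; have [] := polar_sq e0 eU xS.
rewrite Rintegral_cst// ler_pM2l//; apply: fine_le.
- by rewrite ge0_fin_numE ?mu2_sqbounded.
- by rewrite ge0_fin_numE ?mu2_sqbounded.
- by apply: le_measure => //; rewrite inE.
Qed.

(** [S1] is symmetric, so its first moment vanishes; [S2] adds to it only points with nonnegative
    first coordinate, and a box of positive area among them. *)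
Lemma polar_moment_neq0 : axis_value polar_moment 2 1 1 1 != 0.
Proof.
have l2 : (0 : R) < 2 by [].
have bq a : 0 < a -> sqbounded (HP (quad 1 1 a 0 1 0)) by move=> a0; exact: bquad.
have [m1 b1] := polar_regular (bq _ ltr01); have [m2 b2] := polar_regular (bq _ l2).
have S1_0 : Rintegral mu2 (polar (HP (quad 1 1 1 0 1 0))) fst = 0.
  have := axis_value_anti polar_moment_shear polar_moment_swap (@ltr01 R) ltr01 ltr01 ltr01.
  by rewrite /axis_value /quad_value /polar_moment /moment /=; lra.
rewrite /axis_value /quad_value /polar_moment /moment /=.
set S1 := polar (HP (quad 1 1 1 0 1 0)) in m1 b1 S1_0; set S2 := polar _ in m2 b2 *.
(* The box lies under the line from (2, 0) to (0, 1), on which [a / 2 + b = 1], and to the right of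
   (1, 0). *)
pose B : set pt := (`[5 / 4, 3 / 2]%classic : set mR) `*` (`[0, 1 / 4]%classic : set mR).
have mB : measurable (B : set (mR * mR)) by exact: measurableX.
have m21 : measurable (S2 `\` S1 : set (mR * mR)) by exact: measurableD.
have S12 : S1 `<=` S2.
  move=> y yS -[X Y] xP; apply: yS; move: xP; rewrite !halfplanes_cons /dot2 /= => -[h1 [h2 [h3 [h4 h5]]]].
  by do !(split; try lra); exact: halfplanes_nil.
have BS : B `<=` S2 `\` S1.
  move=> [a b] [/=]; rewrite !in_itv /= => /andP[a1 a2] /andP[b1' b2']; split.
    move=> [X Y]; rewrite !halfplanes_cons /dot2 /= => -[h1 [h2 [h3 [h4 _]]]].
    have k1 : a * X <= a * (1 / 2) by rewrite ler_pM2l; lra.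
    have k2 : b * Y <= b * 1 by rewrite ler_wpM2l//; lra.
    lra.
  move=> /(_ (1, 0)); rewrite !halfplanes_cons /dot2 /= => h.
  have : a * 1 + b * 0 <= 1 by apply: h; do !(split; try lra); exact: halfplanes_nil.
  lra.
have pos y : S2 y -> ~ S1 y -> 0 <= y.1.
  case: y => a b y2 y1; rewrite /= leNgt; apply/negP => a0; apply: y1 => -[X Y].
  rewrite !halfplanes_cons /dot2 /= => -[h1 [h2 [h3 [h4 _]]]].
  have k (s : R) : `|s| <= 1 -> - a + b * s <= 1.
    rewrite ler_norml => /andP[s1 s2].
    have := y2 (-1, s); rewrite !halfplanes_cons /dot2 /= => h.
    have : a * -1 + b * s <= 1 by apply: h; do !(split; try lra); exact: halfplanes_nil.
    lra.
  have kY : - a + b * Y <= 1 by apply: k; rewrite ler_norml; apply/andP; split; lra.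
  have : (- a) * (- X) <= (- a) * 1 by rewrite ler_pM2l ?oppr_gt0//; lra.
  lra.
have [i2 _] := integrable_coord m2 b2.
have b21 : sqbounded (S2 `\` S1) by apply: sub_sqbounded b2 => x [].
have bB : sqbounded B by apply: sub_sqbounded b21.
have [i21 _] := integrable_coord m21 b21; have [iB _] := integrable_coord mB bB.
have mBc : measurable ((S2 `\` S1) `\` B : set (mR * mR)) by exact: measurableD.
have e1 : S2 = S1 `|` (S2 `\` S1) by rewrite setDUK.
have e2 : S2 `\` S1 = B `|` ((S2 `\` S1) `\` B) by rewrite setDUK.
rewrite e1 Rintegral_setU//; first last.
- by apply/disj_set2P; apply/seteqP; split=> // x [xA [_ /(_ xA)]].
- by rewrite -e1.
rewrite S1_0 add0r e2 Rintegral_setU//; first last.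
- by apply/disj_set2P; apply/seteqP; split=> // x [xA [_ /(_ xA)]].
- by rewrite -e2.
have h1 : 0 <= Rintegral mu2 ((S2 `\` S1) `\` B) fst.
  by apply: Rintegral_ge0 => x [[x2 x1] _]; exact: pos.
have h2 : Rintegral mu2 B (fun=> 1) <= Rintegral mu2 B fst.
  apply: le_Rintegral => //.
    by apply: (@integrable_bounded _ _ _ 1) => // x _; rewrite normr1.
  by move=> -[a b] [/=]; rewrite !in_itv /= => /andP[? ?] _; lra.
have h3 : 0 < Rintegral mu2 B (fun=> 1).
  rewrite Rintegral_cst// mul1r [X in fine X](_ : _ = (1 / 4 * (1 / 4))%:E); last first.
    have s1 : lebesgue_measure (`[5 / 4, 3 / 2]%classic : set R) = (1 / 4)%:E.
      by rewrite lebesgue_measure_itv /= lte_fin ifT; [rewrite -EFinB; congr EFin; lra|lra].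
    have s2 : lebesgue_measure (`[0, 1 / 4]%classic : set R) = (1 / 4)%:E.
      by rewrite lebesgue_measure_itv /= lte_fin ifT; [rewrite -EFinB; congr EFin; lra|lra].
    by rewrite EFinM -{1}s1 -s2; apply: product_measure1E; exact: measurable_itv.
  by rewrite /= mulr_gt0// divr_gt0.
by rewrite gt_eqF//; exact: ltr_wpDr h1 (lt_le_trans h3 h2).
Qed.

End PolarMoment.

(** * A continuous path of quadrilaterals *)

Section Path.
Variable R : realType.
Notation pt := (R * R)%type.
Local Notation HP := (@halfplanes R).
Implicit Types (U V W : seq pt).
Local Notation sq e := (quad e e e 0 e 0).

Section PathCD.
Variables c d : R.
Hypotheses (c0 : 0 < c) (d0 : 0 < d).
Let m := Num.min c d.

Lemma min_poles_gt0 : 0 < m. Proof. by rewrite lt_min c0. Qed.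

(** The abscissa [m] on the left keeps the quadrilateral admissible for all [|t| <= 1]. *)
Definition path (t : R) : set pt := HP (quad c d 1 t m 0).

Lemma path_Po t : Po (path t).
Proof. by apply: halfplanes_Po; apply: bquad => //; exact: min_poles_gt0. Qed.

(** Only the constraint of [(1, t)] changes. Moving a point horizontally onto it costs at most
    [|t - s| * |Y|], and [|Y| <= 1 / m]; [|t| < 1] keeps the left constraint valid. *)
Lemma path_close s t e : `|t| < 1 -> `|t - s| < m * e ->
  forall x, path s x -> exists y, path t y /\ dist2 x y < e.
Proof.
move=> t1 ts [X Y]; rewrite /path !halfplanes_cons /dot2 /= => -[h1 [h2 [h3 [h4 _]]]].
have m0 := min_poles_gt0.
have mc : m <= c by rewrite ge_min lexx.
have md : m <= d by rewrite ge_min lexx orbT.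
have nY : m * `|Y| <= 1.
  have [Y0|/ltW Y0] := leP 0 Y.
    have : m * Y <= c * Y by rewrite ler_wpM2r.
    rewrite ger0_norm//; lra.
  have : m * - Y <= d * - Y by rewrite ler_wpM2r// oppr_ge0.
  rewrite ler0_norm//; lra.
have ab (a : R) : m * (a * Y) <= `|a|.
  apply: le_trans (ler_norm _) _; rewrite !normrM (gtr0_norm m0) mulrCA.
  by rewrite -[leRHS]mulr1 ler_wpM2l.
exists (Num.min X (1 - t * Y), Y); split.
  have hm1 : Num.min X (1 - t * Y) <= 1 - t * Y by rewrite ge_min lexx orbT.
  have hm2 : - m * Num.min X (1 - t * Y) <= 1.
    case: (leP X (1 - t * Y)) => _; first lra.
    by have := ab t; lra.
  rewrite /path !halfplanes_cons /dot2 /=.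
  by do !(split; try lra); exact: halfplanes_nil.
rewrite /dist2 /= subrr expr0n /= addr0 sqrtr_sqr.
have e0 : 0 < e by rewrite -(pmulr_rgt0 _ m0); apply: le_lt_trans ts.
case: (leP X (1 - t * Y)) => hX; first by rewrite subrr normr0.
rewrite gtr0_norm ?subr_gt0// -(ltr_pM2l m0).
have : m * (X - (1 - t * Y)) <= m * ((t - s) * Y) by rewrite ler_pM2l//; lra.
by have := ab (t - s); lra.
Qed.

(** Families with measurable preimage form a sigma-algebra, and [path_close] in both directions
    makes preimages of Hausdorff-open families open. *)
Lemma measurable_path (A : set (set pt)) : <<s (@Po R), (@Hopen R) >> A ->
  measurable [set t : R | `|t| < 1 /\ A (path t)].
Proof.
have ballE : [set t : R | `|t| < 1] = ball 0 1.
  by apply/seteqP; split=> t; rewrite /ball /= sub0r normrN.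
have mball : measurable [set t : R | `|t| < 1].
  by rewrite ballE; apply: open_measurable; exact: ball_open.
pose Y := [set A : set (set pt) | measurable [set t : R | `|t| < 1 /\ A (path t)]].
suff : <<s (@Po R), (@Hopen R) >> `<=` Y by apply.
apply: smallest_sub.
  split.
  - rewrite /Y /= (_ : [set _ | _] = set0); first exact: measurable0.
    by apply/seteqP; split=> // t [].
  - move=> B; rewrite /Y /= => mB.
    rewrite (_ : [set _ | _] = [set t : R | `|t| < 1] `\` [set t : R | `|t| < 1 /\ B (path t)]).
      exact: measurableD.
    apply/seteqP; split=> t /=.
      by move=> [t1 [_ nB]]; split=> // -[].
    by move=> [t1 nB]; split=> //; split; [exact: path_Po|move=> Bt; exact: nB].
  - move=> F mF; rewrite /Y /=.
    rewrite (_ : [set _ | _] = \bigcup_n [set t : R | `|t| < 1 /\ F n (path t)]).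
      exact: bigcupT_measurable.
    apply/seteqP; split=> t /=; first by move=> [t1 [n _ Fn]]; exists n.
    by move=> [n _ [t1 Fn]]; split=> //; exists n.
move=> B [_ oB]; rewrite /Y /=; apply: open_measurable; rewrite openE => s [s1 Bs].
have [e e0 he] := oB _ Bs.
have : nbhs s [set t : R | `|t| < 1].
  rewrite ballE; apply: open_nbhs_nbhs; split; first exact: ball_open.
  by rewrite -ballE.
move=> /nbhs_ballP[r /= r0 hr].
apply/nbhs_ballP; exists (Num.min r (m * e)).
  by rewrite /= lt_min r0 mulr_gt0// min_poles_gt0.
move=> t; rewrite /ball /= lt_min => /andP[tr te].
have t1 : `|t| < 1 by exact: hr.
split=> //; apply: he; first exact: path_Po.
split=> x; first by apply: path_close => //; rewrite distrC.
move=> /(path_close s1 te) [y [ys xy]]; exists y; split=> //.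
by move: xy; rewrite /dist2 -[(x.1 - _) ^+ 2]sqrrN -[(x.2 - _) ^+ 2]sqrrN !opprB.
Qed.

(** The sets [F n] on which the first component is at most [n] in absolute value increase to the
    unit interval. The first component becomes the second one, up to sign, after rotating back. *)
Lemma path_large_set (mu : set pt -> pt) : Borel_measurable_Po mu ->
  exists E : set R, exists M : R, [/\ measurable E, E `<=` `]0, 1[,
    ((3 / 4)%:E < lebesgue_measure E)%E &
    forall t, E t -> `|(mu (path t)).1| <= M].
Proof.
move=> bmu.
pose F (n : nat) : set R := `]0, 1[%classic `&`
  [set t | `|t| < 1 /\ (@Po R `&` mu @^-1` (`[- n%:R, n%:R]%classic `*` setT)) (path t)].
have mF n : measurable (F n).
  apply: measurableI => //; apply: measurable_path; apply: bmu.
  by apply: measurableX => //; exact: measurable_itv.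
have F1 n t : F n t -> `|(mu (path t)).1| <= n%:R.
  by move=> [_ [_ [_ [/=]]]]; rewrite in_itv /= -ler_norml.
have UF : \bigcup_n F n = `]0, 1[%classic.
  apply/seteqP; split=> [t [n _ []]//|t t01].
  exists (Num.truncn `|(mu (path t)).1|).+1 => //; split=> //.
  have /andP[t0 t1] : 0 < t < 1 by move: t01; rewrite /= in_itv.
  split; first by rewrite gtr0_norm.
  split; first exact: path_Po.
  split=> //=; rewrite in_itv /= -ler_norml.
  by have /andP[_ /ltW] := truncn_itv (normr_ge0 (mu (path t)).1).
have ndF : nondecreasing_seq F.
  move=> n k nk; apply/subsetPset => t [t01 [t1 [tP [/= + _]]]].
  rewrite in_itv /= -ler_norml => h; split=> //; split=> //; split=> //; split=> //=.
  by rewrite in_itv /= -ler_norml; apply: le_trans h _; rewrite ler_nat.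
have mUF : measurable (\bigcup_n F n) by exact: bigcupT_measurable.
have := nondecreasing_cvg_mu (mu := lebesgue_measure) mF mUF ndF.
rewrite UF => cvF.
have [[n hn]|no] := pselect (exists n, ((3 / 4)%:E < lebesgue_measure (F n))%E).
  exists (F n), n%:R; split=> //; first by move=> t [].
  exact: F1.
exfalso.
have le34 n : (lebesgue_measure (F n) <= (3 / 4)%:E)%E.
  by rewrite leNgt; apply/negP => h; apply: no; exists n.
have : (limn (lebesgue_measure \o F) <= (3 / 4)%:E)%E.
  apply: lime_le; first by apply/cvg_ex; eexists; exact: cvF.
  by apply: nearW => n; exact: le34.
have l01 : lebesgue_measure (`]0, 1[%classic : set R) = 1%:E.
  by rewrite lebesgue_measure_itv /= lte_fin ltr01 -EFinB subr0.
have -> : limn (lebesgue_measure \o F) = 1%:E.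
  by rewrite -l01; apply: cvg_lim => //; exact: cvF.
by rewrite lee_fin; lra.
Qed.

(** On [E'] the defect differs from the second component by bounded terms; every small [h] is a
    difference of two points of [E'], so additivity bounds the defect there. *)
Lemma defect_linear_of_bounded (N : set pt -> pt) (E' : set R) (M : R) :
  hp_valuation N -> (forall t, hp_covariant N 1 0 t 1) -> hp_covariant N 0 1 1 0 ->
  measurable E' -> E' `<=` `]0, 1[ -> ((3 / 4)%:E < lebesgue_measure E')%E ->
  (forall t, E' t -> `|(N (path t)).2| <= M) ->
  exists k, forall t, defect N c d t = k * t.
Proof.
move=> Nval Nshear Nswap mE E01 E34 EM.
exists (defect N c d 1) => t.
set K := M + `|coef_fst N c d 1| + `|coef_snd N c d 1| + `|coef_snd N c d m|.
have dK s : E' s -> `|defect N c d s| <= K.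
  move=> Es; have /andP[s0 s1] : 0 < s < 1 by have := E01 _ Es; rewrite /= in_itv.
  have A : adm c d 1 (1 * s) m 0.
    apply: adm_small => //; first exact: min_poles_gt0.
    by rewrite ler_piMr// ?gtr0_norm// ltW// min_poles_gt0.
  have := EM _ Es; rewrite /path -/(quad_value N c d 1 s m 0) -{1}[s]mul1r.
  rewrite (E_slope Nval Nshear Nswap c0 d0 ltr01 min_poles_gt0 A) /=.
  set a := coef_fst _ _ _ _; set b := coef_snd _ _ _ 1; set b' := coef_snd _ _ _ m; set x := defect _ _ _ _.
  move=> h; have -> : x = (s * a + b + b' + x) - s * a - b - b' by ring.
  apply: le_trans (ler_normB _ _) _; rewrite lerD//.
  apply: le_trans (ler_normB _ _) _; rewrite lerD//.
  apply: le_trans (ler_normB _ _) _; rewrite lerD//.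
  by rewrite normrM ler_piMl// gtr0_norm// ltW.
apply: (@additive_bounded_linear R _ (K + K)); first by move=> x y; exact: defect_add.
move=> h h01; have [x Ex Exh] := Steinhaus mE E01 E34 h01.
have -> : defect N c d h = defect N c d (x + h) - defect N c d x.
  by rewrite defect_add//; ring.
by apply: le_trans (ler_normB _ _) _; apply: lerD; exact: dK.
Qed.

End PathCD.
End Path.

(** * The classification *)

Section Transfer.
Variable R : realType.
Notation pt := (R * R)%type.
Local Notation HP := (@halfplanes R).
Implicit Types (U V W : seq pt) (mu : set pt -> pt).

Definition rotate_back mu (P : set pt) : pt := ((mu P).2, - (mu P).1).

Lemma rotate_back_valuation mu : valuation_Po mu -> hp_valuation (rotate_back mu).
Proof.
move=> vmu U V W bU bV bW UVW.
have bUV : sqbounded (HP (U ++ V)) by rewrite halfplanes_cat; apply: sub_sqbounded bU => x [].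
have := vmu _ _ (halfplanes_Po bU) (halfplanes_Po bV).
rewrite UVW -halfplanes_cat => /(_ (halfplanes_Po bW) (halfplanes_Po bUV)).
by rewrite /add2 /rotate_back /= => -[h1 h2]; congr pair; lra.
Qed.

Definition mx2 (a b c d : R) : 'M[R]_2 :=
  \matrix_(i, j) if i == 0 then (if j == 0 then a else b) else (if j == 0 then c else d).

Lemma det_mx2 a b c d : \det (mx2 a b c d) = a * d - b * c.
Proof.
rewrite (expand_det_row _ 0) !big_ord_recl big_ord0 /cofactor !det_mx11 !mxE /=.
by rewrite addr0 expr0 expr1; ring.
Qed.

Lemma lapp_mx2 a b c d x : lapp (mx2 a b c d) x = lin a b c d x.
Proof. by rewrite /lapp /lin !mxE. Qed.

(* The primed matrix is the inverse transpose of the other one: it acts on the polygon when the latter acts on the constraints. *)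
Lemma rotate_back_covariant mu (a b c d a' b' c' d' : R) : VL2_signum_covariant mu ->
  a' * d' - b' * c' = 1 \/ a' * d' - b' * c' = -1 ->
  cancel (lin a c b d) (lin a' b' c' d') -> cancel (lin a' b' c' d') (lin a c b d) ->
  (forall x, lin a b c d (x.2, - x.1) = ((a' * d' - b' * c') * (lin a' b' c' d' x).2,
     - ((a' * d' - b' * c') * (lin a' b' c' d' x).1))) ->
  hp_covariant (rotate_back mu) a b c d.
Proof.
move=> cmu det1 K K' rot U bU.
have eU : HP (map (lin a b c d) U) = limage (mx2 a' b' c' d') (HP U).
  apply/seteqP; split=> x.
    move=> /halfplanes_lin xU; exists (lin a c b d x) => //.
    by rewrite lapp_mx2 K.
  by move=> [y yU <-]; apply/halfplanes_lin; rewrite lapp_mx2 K'.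
rewrite /rotate_back eU cmu ?det_mx2//; last by exact: halfplanes_Po.
  by rewrite rot /scale2 lapp_mx2.
by rewrite /VL2 det_mx2.
Qed.

Lemma rotate_back_shear mu t : VL2_signum_covariant mu -> hp_covariant (rotate_back mu) 1 0 t 1.
Proof.
move=> cmu; apply: (@rotate_back_covariant mu 1 0 t 1 1 (- t) 0 1 cmu).
- by left; ring.
- by move=> [x y]; rewrite lin_comp /lin /=; congr pair; ring.
- by move=> [x y]; rewrite lin_comp /lin /=; congr pair; ring.
- by move=> [x y]; rewrite /lin /=; congr pair; ring.
Qed.

Lemma rotate_back_swap mu : VL2_signum_covariant mu -> hp_covariant (rotate_back mu) 0 1 1 0.
Proof.
move=> cmu; apply: (@rotate_back_covariant mu 0 1 1 0 0 1 1 0 cmu).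
- by right; ring.
- by move=> [x y]; rewrite lin_comp /lin /=; congr pair; ring.
- by move=> [x y]; rewrite lin_comp /lin /=; congr pair; ring.
- by move=> [x y]; rewrite /lin /=; congr pair; ring.
Qed.

Definition combine (N N' : set pt -> pt) (k : R) (P : set pt) : pt :=
  ((N P).1 - k * (N' P).1, (N P).2 - k * (N' P).2).

Lemma combine_valuation N N' k : hp_valuation N -> hp_valuation N' -> hp_valuation (combine N N' k).
Proof.
move=> v v' U V W bU bV bW UVW.
have [] := v _ _ _ bU bV bW UVW; have [] := v' _ _ _ bU bV bW UVW.
move=> /(congr1 ( *%R k)) h1 /(congr1 ( *%R k)) h2 h3 h4.
by rewrite /combine /add2 /=; congr pair; lra.
Qed.

Lemma combine_covariant N N' k a b c d : hp_covariant N a b c d -> hp_covariant N' a b c d ->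
  hp_covariant (combine N N' k) a b c d.
Proof.
move=> v v' U bU; rewrite /combine v// v'// /lin /=; congr pair; ring.
Qed.

End Transfer.

Theorem theorem3p9 (R : realType) (mu : set (R * R) -> R * R) :
  Borel_measurable_Po mu -> valuation_Po mu -> VL2_signum_covariant mu ->
  exists k : R, forall P : set (R * R), Po P ->
    mu P = scale2 k (rot90 (moment (polar P))).
Proof.
move=> bmu vmu cmu.
set N1 := rotate_back mu; set N2 := @polar_moment R.
pose k := axis_value N1 2 1 1 1 / axis_value N2 2 1 1 1.
exists k; pose N := combine N1 N2 k.
have Nval : hp_valuation N.
  by apply: combine_valuation; [exact: rotate_back_valuation|exact: polar_moment_valuation].
have Nshear t : hp_covariant N 1 0 t 1.
  by apply: combine_covariant; [exact: rotate_back_shear|exact: polar_moment_shear].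
have Nswap : hp_covariant N 0 1 1 0.
  by apply: combine_covariant; [exact: rotate_back_swap|exact: polar_moment_swap].
have ND : axis_value N 2 1 1 1 = 0.
  rewrite [LHS](_ : _ = axis_value N1 2 1 1 1 - k * axis_value N2 2 1 1 1)// divfK ?subrr//.
  exact: polar_moment_neq0.
have Ndef c d : 0 < c -> 0 < d -> exists k, forall t, defect N c d t = k * t.
  move=> c0 d0; have [A [M [mA A01 A34 AM]]] := path_large_set c0 d0 bmu.
  set m := Num.min c d; have m0 : 0 < m by rewrite lt_min c0.
  (* This sum dominates the coordinates of all four constraints of the path; the 2 is for [(1, t)]
     with [0 < t < 1]. *)
  have e0 : 0 < c + d + m + 2 by rewrite !addr_gt0.
  have [M' hM'] := polar_moment_bounded e0.
  apply: (@defect_linear_of_bounded R c d c0 d0 N A (M + `|k| * M')) => // t At.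
  have /andP[t0 t1] : 0 < t < 1 by have := A01 _ At; rewrite /= in_itv.
  rewrite /N /combine /N1 /rotate_back /=.
  apply: le_trans (ler_normB _ _) _; rewrite normrN normrM; apply: lerD; first exact: AM.
  apply: ler_wpM2l => //; apply: hM'; first exact: bquad.
  set e := _ + 2 in e0 *.
  move=> [X Y] /(sqP _ e0) [/=]; rewrite !ler_norml => /andP[X1 X2] /andP[Y1 Y2].
  have ee : e * e^-1 = 1 by rewrite mulfV// gt_eqF.
  have i0 : 0 < e^-1 by rewrite invr_gt0.
  set i := e^-1 in X1 X2 Y1 Y2 ee i0.
  have bnd s Z : 0 <= s -> - i <= Z -> Z <= i -> s * Z <= s * i /\ - s * Z <= s * i.
    by move=> s0 z1 z2; split; [rewrite ler_wpM2l|rewrite mulNr -mulrN ler_wpM2l//; lra].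
  have [c1 c2] := bnd c Y (ltW c0) Y1 Y2; have [d1 d2] := bnd d Y (ltW d0) Y1 Y2.
  have [m1 m2] := bnd m X (ltW m0) X1 X2; have [y1 y2] := bnd t Y (ltW t0) Y1 Y2.
  have ci : 0 < c * i by rewrite mulr_gt0.
  have di : 0 < d * i by rewrite mulr_gt0.
  have mi : 0 < m * i by rewrite mulr_gt0.
  have ti : t * i <= 1 * i by rewrite ler_pM2r// ltW.
  have {}ee : c * i + d * i + m * i + 2 * i = 1.
    by transitivity (e * i); [rewrite /e; ring|exact: ee].
  rewrite !halfplanes_cons /dot2 /=.
  rewrite -/m; clear -X2 c1 d2 m2 y1 ci di mi ti ee i0.
  by do !(split; try lra); exact: halfplanes_nil.
move=> P /Po_halfplanes [U bU ->].
have := polygon_vanish Nval Nshear Nswap (E_eq0 Nval Nshear Nswap Ndef ND) bU.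
rewrite /N /combine /N1 /N2 /rotate_back /polar_moment /= => -[h1 h2].
by rewrite [LHS]surjective_pairing /scale2 /rot90 /=; congr pair; lra.
Qed.
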